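(* Let $\mathcal{H}=\mathcal{H}(X)$ be a reproducing kernel Hilbert space and let $A,B\in\mathscr{B}(\mathcal{H})$. Then for $r\in\mathbb{N}=\{1,2,\dots\}$, $m\ge1$ and $\zeta\ge0$, $$ \begin{aligned} \mathrm{ber}^{2r}(A^*B)\le{}&\frac{2\zeta+1}{2\zeta+2}\left\|\frac{|B|^{4m}+|A|^{4m}}{2}\right\|_{\mathrm{ber}}^{\frac rm}-\frac{2\zeta+1}{2^r(2\zeta+2)}\inf_{x\in X}\left(\langle|B|^4\hat k_x,\hat k_x\rangle^{\frac r2}-\langle|A|^4\hat k_x,\hat k_x\rangle^{\frac r2}\right)^2\\ &+\frac{1}{2\zeta+2}\,\mathrm{ber}^r\big(|A|^2|B|^2\big). \end{aligned} $$
   Context: Reproducing kernel Hilbert space: $X$ is a non-empty set and $\mathcal{H}=\mathcal{H}(X)$ is a Hilbert space of complex-valued functions on $X$ such that for every $x\in X$ the evaluation $\phi\mapsto\phi(x)$ is continuous on $\mathcal{H}$. For $x\in X$, $k_x\in\mathcal{H}$ is the unique element with $\phi(x)=\langle\phi,k_x\rangle$ for all $\phi\in\mathcal{H}$, and $\hat k_x=k_x/\|k_x\|$ is the normalized reproducing kernel (so it is implicit that $k_x\neq 0$ for all $x\in X$). $\mathscr{B}(\mathcal{H})$ is the algebra of bounded linear operators on $\mathcal{H}$, and $|T|=(T^*T)^{1/2}$; powers of positive operators are defined by functional calculus. For $T\in\mathscr{B}(\mathcal{H})$, the Berezin number is $\mathrm{ber}(T)=\sup_{x\in X}|\langle T\hat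 k_x,\hat k_x\rangle|$ and the Berezin norm is $\|T\|_{\mathrm{ber}}=\sup_{x,y\in X}|\langle T\hat k_x,\hat k_y\rangle|$; $\mathrm{ber}^s(T)$ means $(\mathrm{ber}(T))^s$. The parameter $m$ is a real number. *)

(* Defs.v *)
From HB Require Import structures.
From mathcomp Require Export all_boot all_order all_algebra complex.
From mathcomp Require Export all_classical all_reals all_analysis.
Export Order.TTheory GRing.Theory Num.Theory.
Export numFieldNormedType.Exports.

Set Implicit Arguments.
Unset Strict Implicit.
Unset Printing Implicit Defensive.

Global Open Scope classical_set_scope.
Global Open Scope ring_scope.
Global Open Scope complex_scope.

(* A Hilbert space of complex functions on X: the vectors are identified with
   functions through the injective linear map [eval].  The inner product is
   linear in its first argument. *)
Record rkhs (R : realType) (X : Type) := RKHS {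
  rkhs_space :> completeNormedModType R[i] ;
  inner : {dot rkhs_space for @conjc R} ;
  inner_norm : forall f : rkhs_space, inner f f = `|f| ^+ 2 ;
  eval : rkhs_space -> X -> R[i] ;
  eval_linear : forall x : X, linear (fun f => eval f x : R[i]^o) ;
  eval_inj : injective eval ;
  eval_continuous : forall x : X, continuous (fun f => eval f x : R[i]^o)
}.

Section Operators.
Context {R : realType} {X : Type} {H : rkhs R X}.
Implicit Types (T S : H -> H) (f g : H) (x y : X).

Definition adjoint T : H -> H :=
  get [set S : H -> H | forall f g, inner H (T f) g = inner H f (S g)].

Definition spectrum T : set R[i] :=
  [set z | ~ exists S : {linear H -> H}, continuous S /\
     forall f, S (T f - z *: f) = f /\ T (S f) - z *: S f = f].

Definition op_poly (p : {poly R}) T : H -> H :=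
  fun f => \sum_(i < size p) (p`_i)%:C *: iter i T f.

(* S = h(T) for T self-adjoint (so that its spectrum is real) and h
   continuous on the spectrum: S is the limit in operator norm of p_n(T), for
   polynomials p_n converging to h uniformly on the spectrum of T. *)
Definition is_fun_calc T (h : R -> R) S : Prop :=
  exists p : nat -> {poly R},
    (forall e : R, 0 < e -> \forall n \near \oo, forall t : R,
       spectrum T t%:C -> `|(p n).[t] - h t| <= e) /\
    (forall e : R, 0 < e -> \forall n \near \oo, forall f,
       `|op_poly (p n) T f - S f| <= e%:C * `|f|).

Definition fun_calc T (h : R -> R) : H -> H :=
  get [set S : H -> H | is_fun_calc T h S].

(* Used for T positive and s > 0 only. *)
Definition op_pow T (s : R) : H -> H := fun_calc T (fun t => t `^ s).

Definition op_abs T : H -> H := op_pow (adjoint T \o T) 2^-1.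

Definition kern x : H := get [set k : H | forall f, eval f x = inner H f k].

Definition nkern x : H := `|kern x|^-1 *: kern x.

(* The modulus and the norm take values in R[i], hence the real parts below. *)
Definition ber T : R :=
  sup [set complex.Re `|inner H (T (nkern x)) (nkern x)| | x in [set: X]].

Definition ber_norm T : R :=
  sup [set complex.Re `|inner H (T (nkern x)) (nkern y)|
      | x in [set: X] & y in [set: X]].

(* <T k^_x, k^_x>, as a real number; used for T self-adjoint only. *)
Definition berezin_re T x : R := complex.Re (inner H (T (nkern x)) (nkern x)).

End Operators.

Arguments kern {R X} H x.
Arguments nkern {R X} H x.

(* Main.v *)
(* With P = A^*A and Q = B^*B one has |<A^*B k,k>|^2 <= <Pk,k><Qk,k> for a unit
   vector k, and Buzano's inequality bounds the right-hand side by
   (|Qk||Pk| + |<PQk,k>|)/2.  Raising to the power r, the first term is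
   controlled by (u v)^r <= ((u^2+v^2)/2)^r - 2^-r (u^r - v^r)^2, by the
   convexity of t^m, and by McCarthy's inequality <|A|^4 k,k>^m <= <|A|^4m k,k>.

   The operators are defined by unspecified choice, so existence and uniqueness
   of the adjoint and of t^s(T) have to be proved.  The adjoint and the
   resolvent outside [0, M] of a positive operator come from one variational
   argument (minimise <Tf,f> - 2 l(f)).  The functional calculus rests on
   |p(T)| <= sup_(spectrum T) |p| for symmetric T: if N = |p(T)| then p(T)^2 - N^2
   is not bounded below, hence neither is some factor T - z of p(X)^2 - N^2
   over the complex numbers, and such a z is a real point of the spectrum.
   Bernstein polynomials then approximate t^s. *)
From HB Require Import structures.
Require Import Defs.
From mathcomp Require Import ring lra.

Set Implicit Arguments.
Unset Strict Implicit.
Unset Printing Implicit Defensive.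

(** * The underlying real inner product *)

Section InnerProduct.
Context {R : realType} {X : Type} {H : rkhs R X}.
Implicit Types (f g k : H) (a b c : R).

(* All the estimates are made in the real Hilbert space underlying [H]. *)
Definition ip f g : R := complex.Re (inner H f g).
Definition nm f : R := complex.Re `|f|.

Lemma normE f : `|f| = (nm f)%:C.
Proof. by rewrite RRe_real// ger0_real. Qed.

Lemma nm_ge0 f : 0 <= nm f.
Proof. by rewrite -ler0c -normE. Qed.

Lemma le_normE f c g : (`|f| <= c%:C * `|g|) = (nm f <= c * nm g).
Proof. by rewrite !normE -rmorphM lecR. Qed.

Lemma ReM_real c (z : R[i]) : complex.Re (c%:C * z) = c * complex.Re z.
Proof. by case: z => x y /=; rewrite mul0r subr0. Qed.

Lemma innerC f g : inner H f g = (inner H g f)^*%C.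
Proof. by have := hermitian_subproof (s := inner H) f g; rewrite expr0 mul1r. Qed.

Lemma ipC f g : ip f g = ip g f.
Proof. by rewrite /ip innerC; case: (inner H g f). Qed.

Lemma ipDl f g k : ip (f + g) k = ip f k + ip g k.
Proof. by rewrite /ip linearDl raddfD. Qed.

Lemma ipZl a f k : ip (a%:C *: f) k = a * ip f k.
Proof. by rewrite /ip linearZl_LR ReM_real. Qed.

Lemma ipDr f g k : ip k (f + g) = ip k f + ip k g.
Proof. by rewrite ipC ipDl !(ipC k). Qed.

Lemma ipZr a f k : ip k (a%:C *: f) = a * ip k f.
Proof. by rewrite ipC ipZl ipC. Qed.

Lemma ipNl f k : ip (- f) k = - ip f k.
Proof. by rewrite /ip linearNl raddfN. Qed.

Lemma ipNr f k : ip k (- f) = - ip k f.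
Proof. by rewrite ipC ipNl ipC. Qed.

Definition ipE := (ipDl, ipDr, ipNl, ipNr, ipZl, ipZr).

Lemma ipii f : ip f f = nm f ^+ 2.
Proof. by rewrite /ip inner_norm normE -rmorphXn. Qed.

(** The inner product is conjugate linear on the right, so [ip] alone recovers it and identities for
    [ip] lift to [inner]. *)
Lemma inner_i f g : inner H f g = ip f g +i* ip f ('i%C *: g).
Proof.
rewrite /ip linearZr_LR/=; case: (inner H f g) => x y /=.
by rewrite mul0r mulN1r opprK add0r.
Qed.

Lemma ip_il f g : ip ('i%C *: f) g = - ip f ('i%C *: g).
Proof.
rewrite /ip linearZr_LR linearZl_LR/=; case: (inner H f g) => x y /=.
by rewrite !mul0r !mul1r mulN1r !sub0r !opprK.
Qed.

Lemma nmZ a f : nm (a%:C *: f) = `|a| * nm f.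
Proof.
rewrite /nm normrZ normE -complexr0 normc_def/= expr0n/= addr0 sqrtr_sqr.
by rewrite mul0r subr0.
Qed.

Lemma nmZc (z : R[i]) f : nm (z *: f) = complex.Re `|z| * nm f.
Proof. by rewrite /nm normrZ normE -(RRe_real (normr_real z)) ReM_real. Qed.

Lemma Re_norm_ge0 (z : R[i]) : 0 <= complex.Re `|z|.
Proof. by rewrite -ler0c RRe_real. Qed.

Lemma nmD f g : nm (f + g) <= nm f + nm g.
Proof. by rewrite -lecR rmorphD/= -!normE ler_normD. Qed.

Lemma nmN f : nm (- f) = nm f. Proof. by rewrite /nm normrN. Qed.

Lemma nmB f g : nm (f - g) = nm (g - f).
Proof. by rewrite -opprB nmN. Qed.

Lemma nm0 : nm 0 = 0. Proof. by rewrite /nm normr0. Qed.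

Lemma nm_eq0 f : nm f = 0 -> f = 0.
Proof. by move=> f0; apply/eqP; rewrite -normr_eq0 normE f0. Qed.

Lemma nm_gt0 f : f != 0 -> 0 < nm f.
Proof.
by move=> f0; rewrite lt_def nm_ge0 andbT; apply: contraNneq f0 => /nm_eq0->.
Qed.

(** Cauchy-Schwarz, by expanding the squared norm of [|g| f - |f| g]. *)
Lemma ip_le f g : ip f g <= nm f * nm g.
Proof.
have [->|/nm_gt0 f0] := eqVneq f 0; first by rewrite nm0 mul0r /ip linear0l.
have [->|/nm_gt0 g0] := eqVneq g 0; first by rewrite nm0 mulr0 /ip linear0r.
have : 0 <= ip ((nm g)%:C *: f - (nm f)%:C *: g) ((nm g)%:C *: f - (nm f)%:C *: g).
  by rewrite ipii sqr_ge0.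
rewrite !ipE !ipii (ipC g f).
rewrite [X in 0 <= X](_ : _ = 2 * (nm f * nm g) * (nm f * nm g - ip f g)); last by ring.
by rewrite pmulr_rge0 ?subr_ge0// !mulr_gt0.
Qed.

Lemma norm_ip_le f g : `|ip f g| <= nm f * nm g.
Proof. by rewrite ler_norml ip_le andbT lerNl -ipNl -(nmN f) ip_le. Qed.

(** Multiplying [f] by a unimodular phase makes the inner product real and nonnegative, which
    reduces the claim to [ip_le]. *)
Lemma norm_inner_le f g : complex.Re `|inner H f g| <= nm f * nm g.
Proof.
set z := inner H f g; have [->|z0] := eqVneq z 0.
  by rewrite normr0 mulr_ge0 ?nm_ge0.
have nz : `|z^*%C / `|z| | = 1.
  by rewrite normrM normrV ?unitfE ?normr_eq0// normr_id normcJ divff// normr_eq0.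
have <- : nm ((z^*%C / `|z|) *: f) = nm f by rewrite /nm normrZ nz mul1r.
apply: le_trans (ip_le _ _).
by rewrite /ip linearZl_LR/= -/z mulrAC [z^*%C * _]mulrC -sqr_normc expr2 mulfK ?normr_eq0.
Qed.

Lemma ip_le_inner f g : ip f g <= complex.Re `|inner H f g|.
Proof.
rewrite /ip -lecR [leRHS]RRe_real ?normr_real//; apply: le_trans (normc_ge_Re _).
by rewrite lecR ler_norm.
Qed.

Lemma nm_complete (u : nat -> H) :
  (forall e : R, 0 < e -> exists N, forall m n, (N <= m)%N -> (N <= n)%N ->
     nm (u m - u n) <= e) ->
  exists l, forall e : R, 0 < e -> exists N, forall n, (N <= n)%N -> nm (u n - l) <= e.
Proof.
move=> cu; have /cauchy_cvg/cvg_ex[l /cvgrPdist_le ul] : cauchy (u @ \oo).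
  apply/cauchy_exP => -[e e'] e0.
  (* A positive element of [R[i]] has zero imaginary part, so the radius is the real number [e]. *)
  have /andP[/eqP/= E e1] : (e' == 0) && (0 < e) by move: e0;
    rewrite ltcE/= => /andP[->].
  have e2 : 0 < e / 2 by lra.
  have [N uN] := cu (e / 2) e2; exists (u N).
  exists N => //= n /= Nn; rewrite -ball_normE/= normE E ltcR.
  apply: le_lt_trans (uN N n (leqnn N) Nn) _ => //; lra.
exists l => e e0; have /ul[N _ uN] : (0 : R[i]) < e%:C by rewrite ltcR.
by exists N => n Nn; have := uN n Nn; rewrite normE lecR nmB.
Qed.

End InnerProduct.

(** * Variational solution of coercive equations *)

Section BoundedOperators.
Context {R : realType} {X : Type} {H : rkhs R X}.
Implicit Types (f g k : H) (a b c M : R) (T S : H -> H).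

Definition bounded_by M T := forall f, nm (T f) <= M * nm f.
Definition bounded_op T := linear T /\ exists M, bounded_by M T.
(** For complex linear [T] this real condition already forces self-adjointness for [inner], by
    [inner_i]. *)
Definition symmetric_op T := forall f g, ip (T f) g = ip f (T g).

Lemma linear_opD T (lT : linear T) f g : T (f + g) = T f + T g.
Proof. by have := lT 1 f g; rewrite !scale1r. Qed.

Lemma linear_op0 T (lT : linear T) : T 0 = 0.
Proof. by apply: (addrI (T 0)); rewrite -(linear_opD lT) !addr0. Qed.

Lemma linear_opZ T (lT : linear T) (z : R[i]) f : T (z *: f) = z *: T f.
Proof. by have := lT z f 0; rewrite (linear_op0 lT) !addr0. Qed.

Lemma linear_opN T (lT : linear T) f : T (- f) = - T f.
Proof. by rewrite -scaleN1r (linear_opZ lT) scaleN1r. Qed.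

Lemma linear_opB T (lT : linear T) f g : T (f - g) = T f - T g.
Proof. by rewrite (linear_opD lT) linear_opN. Qed.

Lemma bounded_op_gt0 T : bounded_op T -> exists2 M, 0 < M & bounded_by M T.
Proof.
move=> [_ [M TM]]; exists (`|M| + 1); first by rewrite ltr_wpDl.
move=> f; apply: le_trans (TM f) _; rewrite ler_wpM2r ?nm_ge0//.
by rewrite (le_trans (ler_norm _))// lerDl.
Qed.

Lemma ip_inj f g : (forall k, ip k f = ip k g) -> f = g.
Proof.
move=> fg; apply/eqP; rewrite -subr_eq0; apply/eqP/nm_eq0/eqP.
by rewrite -sqrf_eq0 -ipii ipDr ipNr fg subrr.
Qed.

Lemma continuous_bounded_op (T : {linear H -> H}) : continuous T -> bounded_op T.
Proof.
move=> /linear_bounded_continuous/linear_boundedP/pinfty_ex_gt0[[r r'] r0 Tr].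
have r'0 : r' = 0 by move: r0; rewrite ltcE/= => /andP[/eqP].
split; first exact: linearP.
by exists r => f; have := Tr f; rewrite r'0 le_normE.
Qed.

(** Produces the bundled continuous maps that the definition of [spectrum] asks for. *)
Lemma bounded_op_continuous T : bounded_op T ->
  exists2 S : {linear H -> H}, continuous S & S =1 T.
Proof.
move=> bT; have [lT _] := bT; have [M M0 TM] := bounded_op_gt0 bT.
pose S : {linear H -> H} := HB.pack T (GRing.isLinear.Build _ _ _ _ T lT).
exists S => //; apply/linear_bounded_continuous/bounded_funP => r.
exists (M%:C * r) => f fr; apply: le_trans (_ : M%:C * `|f| <= _).
  by rewrite le_normE TM.
by rewrite ler_wpM2l// ler0c ltW.
Qed.

Lemma invSn_le (e : R) : 0 < e -> exists N, forall n, (N <= n)%N -> n.+1%:R^-1 <= e.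
Proof.
move=> e0; have [N _ eN] := near_infty_natSinv_lt (PosNum e0).
by exists N => n /eN/ltW.
Qed.

(* The solution minimises [ip (T f) f - 2 * l f]. *)
Lemma coercive_solve T c (l : H -> R) (L : R) :
  bounded_op T -> symmetric_op T -> 0 < c ->
  (forall f, c * nm f ^+ 2 <= ip (T f) f) ->
  (forall f g, l (f + g) = l f + l g) -> (forall a f, l (a%:C *: f) = a * l f) ->
  (forall f, `|l f| <= L * nm f) ->
  exists g, forall f, ip (T g) f = l f.
Proof.
move=> bT sT c0 Tc lD lZ lL; have [lT _] := bT; have [M M0 TM] := bounded_op_gt0 bT.
pose J f := ip (T f) f - 2 * l f.
have JE f g : J (f + g) = J f + 2 * (ip (T f) g - l g) + ip (T g) g.
  by rewrite /J (linear_opD lT) !ipE lD (sT g) (ipC g); ring.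
have lN f : l (- f) = - l f.
  by rewrite -(scaleN1r f) (_ : -1 = (-1)%:C) ?lZ ?mulN1r// rmorphN1.
(* Completing the square in [nm f] bounds [J] below. *)
have J_ge f : - (L ^+ 2 / c) <= J f.
  have := Tc f; have := le_trans (ler_norm _) (lL f); rewrite /J; set n := nm f.
  move=> h1 h2; have : 0 <= c * (n - L / c) ^+ 2 by rewrite mulr_ge0 ?sqr_ge0 ?ltW.
  have -> : c * (n - L / c) ^+ 2 = c * n ^+ 2 - 2 * (L * n) + L ^+ 2 / c.
    by field; rewrite gt_eqF.
  by lra.
pose m := inf (range J).
have infJ : has_inf (range J).
  by split; [exists (J 0), 0 | exists (- (L ^+ 2 / c)) => _ [f _ <-]].
have m_le f : m <= J f by apply: ge_inf; [case: infJ | exists f].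
have /choice[u uP] n : exists f, J f < m + n.+1%:R^-1.
  have n0 : 0 < n.+1%:R^-1 :> R by rewrite invr_gt0.
  by have [_ [f _ <-] ?] := inf_adherent n0 infJ; exists f.
(* Parallelogram identity for the form of [T]: comparing [J] at the midpoint with [m] makes
   minimising sequences Cauchy. *)
have gap f g : c * nm (f - g) ^+ 2 <= 2 * (J f + J g - 2 * m).
  apply: le_trans (Tc _) _.
  have := m_le ((2^-1)%:C *: (f + g)).
  have -> : J ((2^-1)%:C *: (f + g)) = (J f + J g) / 2 - ip (T (f - g)) (f - g) / 4.
    by rewrite /J (linear_opB lT) (linear_opZ lT) (linear_opD lT) !ipE lZ lD (sT g f) (ipC g); field.
  by lra.
have [g ug] : exists g, forall e : R, 0 < e -> exists N, forall n, (N <= n)%N ->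
  nm (u n - g) <= e.
  apply: nm_complete => e e0.
  have ce0 : 0 < c * e ^+ 2 / 4 by rewrite divr_gt0// mulr_gt0// exprn_gt0.
  have [N hN] := invSn_le ce0.
  exists N => p q /hN hp /hN hq; rewrite -ler_sqr ?nnegrE ?nm_ge0 ?(ltW e0)//.
  rewrite -(ler_pM2l c0); apply: le_trans (gap _ _) _.
  by move: (uP p) (uP q) hp hq; move: (p.+1%:R^-1) (q.+1%:R^-1) (c * e ^+ 2) => x y z;
    lra.
exists g => f; set K := ip (T f) f; set d := ip (T g) f - l f.
have K0 : 0 <= K by apply: le_trans (Tc f); rewrite mulr_ge0 ?sqr_ge0 ?ltW.
(* Minimality along the line [g + t f], obtained from [m <= J (u n + t f)] with an error that
   vanishes as [n] grows. *)
have var t : 0 <= 2 * t * d + t ^+ 2 * K.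
  rewrite -[leRHS]addr0; apply/ler_addgt0Pr => e e0; rewrite addr0.
  have e2 : 0 < e / 2 by lra.
  have [N1 hN1] := invSn_le e2.
  have B0 : 0 < 2 * (`|t| + 1) * M * (nm f + 1).
    by rewrite !mulr_gt0 ?ltr_wpDl ?nm_ge0.
  have [N2 hN2] := ug _ (divr_gt0 e2 B0).
  pose n := maxn N1 N2.
  have h1 := hN1 n (leq_maxl _ _); have h2 := hN2 n (leq_maxr _ _).
  have h3 := m_le (u n + t%:C *: f); have h4 := uP n.
  have h5 : 2 * t * (ip (T (u n)) f - ip (T g) f) <= e / 2.
    rewrite -ipNl -ipDl -(linear_opB lT); apply: le_trans (ler_norm _) _.
    rewrite normrM (normrM 2) ger0_norm//.
    apply: le_trans (_ : 2 * (`|t| + 1) * (M * (e / 2 / (2 * (`|t| + 1) * M * (nm f +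
      1))) * (nm f + 1)) <= _); last first.
      rewrite le_eqVlt; apply/orP; left; apply/eqP; field.
      by rewrite !gt_eqF ?ltr_wpDl ?nm_ge0.
    apply: ler_pM; rewrite ?normr_ge0 ?mulr_ge0//.
      by rewrite ler_pM2l// lerDl.
    apply: le_trans (norm_ip_le _ _) _; apply: ler_pM; rewrite ?nm_ge0 ?lerDl//.
    by apply: le_trans (TM _) _; rewrite ler_pM2l.
  move: h3; rewrite JE (linear_opZ lT) !ipE lZ -/K => h3.
  have -> : d = (ip (T (u n)) f - l f) - (ip (T (u n)) f - ip (T g) f) by rewrite /d;
    ring.
  by move: h1 h3 h4 h5; move: (n.+1%:R^-1) (ip (T (u n)) f) => x y; lra.
(* The vertex of the parabola would be [- d / K]; the denominator [K + 1] also covers [K = 0] and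
   still gives a negative multiple of [d ^+ 2]. *)
have := var (- d / (K + 1)).
have K1 : 0 < K + 1 by lra.
have -> : 2 * (- d / (K + 1)) * d + (- d / (K + 1)) ^+ 2 * K =
  - (d ^+ 2 * ((K + 2) / (K + 1) ^+ 2)).
  by field; rewrite gt_eqF.
rewrite oppr_ge0 pmulr_lle0; last by rewrite divr_gt0 ?exprn_gt0//; lra.
move=> d0; have /eqP : d ^+ 2 = 0 by apply: le_anti; rewrite d0 sqr_ge0.
by rewrite sqrf_eq0 subr_eq0 => /eqP.
Qed.

Lemma bounded_op_id : bounded_op (id : H -> H).
Proof. by split => //; exists 1 => f; rewrite mul1r. Qed.

(** Riesz representation, that is [coercive_solve] for the identity, supplies an operator with the
    adjoint property, so the choice in [adjoint] has it too. *)
Lemma adjoint_inner T f g : bounded_op T -> inner H (T f) g = inner H f (adjoint T g).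
Proof.
move=> bT; suff : [set S | forall f g, inner H (T f) g =
  inner H f (S g)] (adjoint T) by apply.
have [lT _] := bT; have [M M0 TM] := bounded_op_gt0 bT.
have /choice[S SP] k : exists h, forall f, ip h f = ip (T f) k.
  apply: (@coercive_solve id 1 (fun f => ip (T f) k) (M * nm k)) => //.
  - exact: bounded_op_id.
  - by move=> f'; rewrite mul1r ipii.
  - by move=> ? ?; rewrite (linear_opD lT) ipDl.
  - by move=> ? ?; rewrite (linear_opZ lT) ipZl.
  - move=> f'; apply: le_trans (norm_ip_le _ _) _; rewrite mulrAC.
    by rewrite ler_wpM2r ?nm_ge0.
apply: (@getPex _ [set S | forall f g, inner H (T f) g = inner H f (S g)]).
(* Real parts agree by construction; imaginary parts follow by moving ['i] across, as [T] is complex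
   linear. *)
exists S => f' g'; rewrite !inner_i -SP ipC; congr (_ +i* _).
by apply: oppr_inj; rewrite -!ip_il -(linear_opZ lT) -SP ipC.
Qed.

Lemma adjoint_ip T f g : bounded_op T -> ip (T f) g = ip f (adjoint T g).
Proof. by move=> bT; rewrite /ip adjoint_inner. Qed.

(** The bound comes from [|T' f|^2 = <T (T' f), f> <= M |T' f| |f|], where [T'] is the adjoint. *)
Lemma bounded_adjoint T : bounded_op T -> bounded_op (adjoint T).
Proof.
move=> bT; have [lT _] := bT; have [M M0 TM] := bounded_op_gt0 bT; split.
  move=> a f g; apply: ip_inj => k; rewrite -adjoint_ip// !ipDr -adjoint_ip//.
  by congr (_ + _); rewrite /ip !linearZr_LR/= adjoint_inner.
exists M => f; have [->|h0] := eqVneq (adjoint T f) 0.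
  by rewrite nm0 mulr_ge0 ?nm_ge0 ?ltW.
rewrite -(ler_pM2l (nm_gt0 h0)) -expr2 -ipii -adjoint_ip//.
apply: le_trans (ip_le _ _) _; rewrite mulrA [_ * M]mulrC.
by rewrite ler_wpM2r ?nm_ge0.
Qed.

Lemma bounded_comp T S : bounded_op T -> bounded_op S -> bounded_op (T \o S).
Proof.
move=> bT bS; have [M M0 TM] := bounded_op_gt0 bT; have [N N0 SN] := bounded_op_gt0 bS.
split; first by move=> a f g /=; rewrite bS.1 bT.1.
exists (M * N) => f /=; apply: le_trans (TM _) _.
by rewrite -mulrA ler_pM2l.
Qed.

Lemma bounded_comb T S (z w : R[i]) : bounded_op T -> bounded_op S ->
  bounded_op (fun f => z *: T f + w *: S f).
Proof.
move=> bT bS; have [M M0 TM] := bounded_op_gt0 bT; have [N N0 SN] := bounded_op_gt0 bS.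
split.
  move=> a f g /=; rewrite bS.1 bT.1 !scalerDr !scalerA !(mulrC a).
  by rewrite -!addrA; congr (_ + _); rewrite addrCA.
exists (complex.Re `|z| * M + complex.Re `|w| * N) => f.
apply: le_trans (nmD _ _) _; rewrite mulrDl !nmZc -!mulrA.
by rewrite lerD// ler_wpM2l// Re_norm_ge0.
Qed.

(** Surjectivity is [coercive_solve]; coercivity and Cauchy-Schwarz give [c |f| <= |T f|], hence
    injectivity and the bound [1 / c] for the inverse. *)
Lemma coercive_invertible T c : bounded_op T -> symmetric_op T -> 0 < c ->
  (forall f, c * nm f ^+ 2 <= ip (T f) f) ->
  exists S, [/\ bounded_op S, cancel T S & cancel S T].
Proof.
move=> bT sT c0 Tc; have [lT _] := bT.
have /choice[S SP] k : exists h, T h = k.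
  have [|||h hP] := @coercive_solve T c (ip k) (nm k) bT sT c0 Tc.
  - by move=> ? ?; rewrite ipDr.
  - by move=> ? ?; rewrite ipZr.
  - by move=> f; apply: norm_ip_le.
  - by exists h; apply: ip_inj => f; rewrite ipC hP ipC.
have cn f : c * nm f <= nm (T f).
  have [->|f0] := eqVneq f 0; first by rewrite nm0 mulr0 nm_ge0.
  by rewrite -(ler_pM2r (nm_gt0 f0)) -mulrA -expr2 (le_trans (Tc f))// ip_le.
have injT f g : T f = T g -> f = g.
  move=> fg; apply/eqP; rewrite -subr_eq0; apply/eqP/nm_eq0/le_anti.
  by rewrite nm_ge0 -(pmulr_rle0 _ c0) (le_trans (cn _))// (linear_opB lT) fg subrr nm0.
exists S; split => // [|f]; last by apply: injT; rewrite SP.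
split; first by move=> a f g; apply: injT; rewrite lT !SP.
by exists c^-1 => f; rewrite ler_pdivlMl// (le_trans (cn _))// SP.
Qed.

Lemma spectrum_itv T M t : bounded_op T -> symmetric_op T ->
  (forall f, 0 <= ip (T f) f) -> bounded_by M T -> spectrum T t%:C -> 0 <= t <= M.
Proof.
move=> bT sT T0 TM st; apply: contrapT => tM; apply: st.
(* The sign [s] makes [U = s (T - t)] coercive; the constant [c] is the gap between [t] and the
   bound, [0] or [M], that it violates. *)
pose s : R := if t < 0 then 1 else -1.
pose U := fun f => s%:C *: T f + (- s * t)%:C *: f.
have bU : bounded_op U by apply: bounded_comb => //; exact: bounded_op_id.
have sU : symmetric_op U by move=> f g; rewrite !ipE sT.
pose c := if t < 0 then - t else t - M.
have c0 : 0 < c.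
  rewrite /c; case: (ltP t 0) => t0; first by rewrite oppr_gt0.
  by rewrite subr_gt0 ltNge; apply/negP => ?; apply: tM; rewrite t0.
have Uc f : c * nm f ^+ 2 <= ip (U f) f.
  rewrite !ipE ipii /c /s; have := T0 f.
  have : ip (T f) f <= M * nm f ^+ 2.
    by rewrite expr2 mulrA (le_trans (ip_le _ _))// ler_wpM2r ?nm_ge0.
  by case: (ltP t 0) => _; lra.
have [S [bS US SU]] := coercive_invertible bU sU c0 Uc.
(* The inverse of [T - t] is [s S]; the summand with coefficient 0 only fits it to
   [bounded_comb]. *)
have bV : bounded_op (fun f => s%:C *: S f + 0 *: S f) by apply: bounded_comb.
have [V cV VE] := bounded_op_continuous bV; exists V; split => // f.
have s2 : s%:C * s%:C = 1 by rewrite -rmorphM /s; case: ifP;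
  rewrite ?mulr1// mulrNN mulr1.
have TU g : T g - t%:C *: g = s%:C *: U g.
  by rewrite /U scalerDr !scalerA s2 scale1r mulNr rmorphN rmorphM mulrN mulrA s2 mul1r scaleNr.
split.
  by rewrite VE scale0r addr0 TU (linear_opZ bS.1) US scalerA s2 scale1r.
by rewrite TU VE scale0r addr0 (linear_opZ bU.1) SU scalerA s2 scale1r.
Qed.

End BoundedOperators.

(** * Polynomials of a symmetric operator *)

Section PolynomialCalculus.
Context {R : realType} {X : Type} {H : rkhs R X}.
Implicit Types (f g : H) (a b c M : R) (T S : H ->
  H) (p q : {poly R}) (P Q : {poly R[i]}).

(** Complex coefficients allow a real polynomial in [T] to be split into linear factors. *)
Definition op_cpoly P T : H -> H := fun f => \sum_(i < size P) P`_i *: iter i T f.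

Lemma op_cpoly_widen n P T f : (size P <= n)%N ->
  op_cpoly P T f = \sum_(i < n) P`_i *: iter i T f.
Proof.
move=> Pn; rewrite /op_cpoly (big_ord_widen n (fun i => P`_i *: iter i T f))//.
rewrite big_mkcond/=; apply: eq_bigr => i _; case: ltnP => // Pi.
by rewrite nth_default// scale0r.
Qed.

Lemma op_cpolyD P Q T f : op_cpoly (P + Q) T f = op_cpoly P T f + op_cpoly Q T f.
Proof.
rewrite !(@op_cpoly_widen (maxn (size P) (size Q))) ?leq_maxl ?leq_maxr ?size_polyD//.
by rewrite -big_split/=; apply: eq_bigr => i _; rewrite coefD scalerDl.
Qed.

Lemma op_cpolyC (z : R[i]) T f : op_cpoly z%:P T f = z *: f.
Proof.
by rewrite (@op_cpoly_widen 1) ?size_polyC_leq1// big_ord1 coefC eqxx.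
Qed.

Lemma op_cpolyMX P T f : op_cpoly (P * 'X) T f = op_cpoly P T (T f).
Proof.
rewrite (@op_cpoly_widen (size P).+1); last first.
  by rewrite (leq_trans (size_polyMleq _ _))// size_polyX addn2.
rewrite big_ord_recl coefMX eqxx scale0r add0r; apply: eq_bigr => i _.
by rewrite lift0 coefMX iterSr.
Qed.

Lemma op_cpolyMXaddC P (z : R[i]) T f :
  op_cpoly (P * 'X + z%:P) T f = op_cpoly P T (T f) + z *: f.
Proof. by rewrite op_cpolyD op_cpolyMX op_cpolyC. Qed.

Lemma op_cpoly0 T f : op_cpoly 0 T f = 0.
Proof. by rewrite -polyC0 op_cpolyC scale0r. Qed.

Lemma op_cpolyT P T f : linear T -> op_cpoly P T (T f) = T (op_cpoly P T f).
Proof.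
move=> lT; elim/poly_ind: P f => [|P z IH] f;
  first by rewrite !op_cpoly0 (linear_op0 lT).
by rewrite !op_cpolyMXaddC (linear_opD lT) (linear_opZ lT) IH.
Qed.

Lemma op_cpoly_linear P T : linear T -> linear (op_cpoly P T).
Proof.
move=> lT; elim/poly_ind: P => [|P z IH] a f g;
  first by rewrite !op_cpoly0 scaler0 addr0.
rewrite !op_cpolyMXaddC lT IH !scalerDr !scalerA (mulrC z) -!addrA; congr (_ + _).
by rewrite addrCA.
Qed.

Lemma op_cpolyM P Q T f : linear T ->
  op_cpoly (P * Q) T f = op_cpoly P T (op_cpoly Q T f).
Proof.
move=> lT; elim/poly_ind: P f => [|P z IH] f; first by rewrite mul0r !op_cpoly0.
rewrite mulrDl mulrAC op_cpolyD op_cpolyMX IH op_cpolyMXaddC op_cpolyT//.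
congr (_ + _); rewrite mul_polyC; move: (op_cpoly_linear Q lT) => lQ.
rewrite (@op_cpoly_widen (size Q)) ?size_scale_leq// scaler_sumr.
by apply: eq_bigr => i _; rewrite coefZ scalerA.
Qed.

(** Passes to composites and asks for no surjectivity; its failure for [T - z] says that [z] is an
    approximate eigenvalue. *)
Definition bounded_below T := exists2 c, 0 < c & forall f, c * nm f <= nm (T f).

(** Roots are split off one at a time over the algebraically closed [R[i]], and the lower bounds of
    the factors multiply. *)
Lemma op_cpoly_bounded_below P T : linear T -> P != 0 ->
  (forall z, root P z -> bounded_below (fun f => T f - z *: f)) ->
  bounded_below (op_cpoly P T).
Proof.
move=> lT; have [n] := ubnP (size P); elim: n P => // n IH P Pn P0 rP.
have [/eqP sP|sP] := boolP (size P == 1).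
  have /size_poly1P[z z0 PE] : size P == 1 by apply/eqP.
  exists (complex.Re `|z|); first by rewrite -ltcR RRe_real// normr_gt0.
  by move=> f; rewrite PE op_cpolyC nmZc.
have [z zP] := closed_rootP P sP.
have [Q PE] := factor_theorem P z zP.
have Q0 : Q != 0 by apply: contraNneq P0 => Q0; rewrite PE Q0 mul0r.
have [||c c0 hc] := IH Q _ Q0.
- by move: Pn; rewrite PE size_Mmonic ?monicXsubC// size_XsubC addn2.
- by move=> w wQ; apply: rP; rewrite PE rootM wQ.
have [d d0 hd] := rP z zP.
exists (c * d) => [|f]; first exact: mulr_gt0.
rewrite PE op_cpolyM// -mulrA (le_trans _ (hc _))// ler_pM2l//.
rewrite (_ : op_cpoly _ _ _ = T f - z *: f) ?hd//.
by rewrite -(mul1r 'X) -polyCN op_cpolyMXaddC op_cpolyC scale1r scaleNr.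
Qed.

Lemma op_polyE p T : op_poly p T = op_cpoly (map_poly (real_complex R) p) T.
Proof.
apply/funext => f; rewrite /op_cpoly size_map_poly.
by apply: eq_bigr => i _; rewrite coef_map.
Qed.

Lemma op_polyD p q T f : op_poly (p + q) T f = op_poly p T f + op_poly q T f.
Proof. by rewrite !op_polyE rmorphD op_cpolyD. Qed.

Lemma op_polyC a T f : op_poly a%:P T f = a%:C *: f.
Proof. by rewrite op_polyE map_polyC op_cpolyC. Qed.

Lemma op_polyM p q T f : linear T -> op_poly (p * q) T f = op_poly p T (op_poly q T f).
Proof. by move=> lT; rewrite !op_polyE rmorphM op_cpolyM. Qed.

Lemma op_polyZ a p T f : linear T -> op_poly (a *: p) T f = a%:C *: op_poly p T f.
Proof. by move=> lT; rewrite -mul_polyC op_polyM// op_polyC. Qed.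

Lemma op_polyB p q T f : linear T ->
  op_poly (p - q) T f = op_poly p T f - op_poly q T f.
Proof. by move=> lT; rewrite op_polyD -scaleN1r op_polyZ// rmorphN scaleN1r. Qed.

Lemma op_polyX T f : op_poly 'X T f = T f.
Proof. by rewrite op_polyE map_polyX -(mul1r 'X) op_cpolyMX op_cpolyC scale1r. Qed.

Lemma op_polyMXaddC p a T f : op_poly (p * 'X + a%:P) T f =
  op_poly p T (T f) + a%:C *: f.
Proof. by rewrite op_polyD op_polyC !op_polyE rmorphM/= map_polyX op_cpolyMX. Qed.

Lemma op_polyT p T f : linear T -> op_poly p T (T f) = T (op_poly p T f).
Proof. by move=> lT; rewrite op_polyE op_cpolyT. Qed.

Lemma op_poly_linear p T : linear T -> linear (op_poly p T).
Proof. by move=> lT; rewrite op_polyE; exact: op_cpoly_linear. Qed.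

Lemma op_poly_bounded p T : bounded_op T -> bounded_op (op_poly p T).
Proof.
move=> bT; have [lT _] := bT; split; first exact: op_poly_linear.
elim/poly_ind: p => [|p a [M pM]].
  by exists 0 => f; rewrite -polyC0 op_polyC scale0r nm0 mul0r.
have bp : bounded_op (op_poly p T) by split; [exact: op_poly_linear | exists M].
have [_ [N hN]] := bounded_comb 1 a%:C (bounded_comp bp bT) (@bounded_op_id R X H).
by exists N => f; rewrite op_polyMXaddC; have := hN f; rewrite /= scale1r.
Qed.

Lemma op_poly_symmetric p T : linear T -> symmetric_op T -> symmetric_op (op_poly p T).
Proof.
move=> lT sT; elim/poly_ind: p => [|p a IH] f g.
  by rewrite -polyC0 !op_polyC !scale0r /ip linear0l linear0r.
by rewrite !op_polyMXaddC !ipE IH sT op_polyT.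
Qed.

(** Pairing [T f - z f] with [i f] kills the contributions of [T] and of the real part of [z], which
    leaves [- Im z |f|^2]. *)
Lemma bounded_below_im T (z : R[i]) : linear T -> symmetric_op T ->
  complex.Im z != 0 -> bounded_below (fun f => T f - z *: f).
Proof.
move=> lT sT z0; exists `|complex.Im z|; first by rewrite normr_gt0.
move=> f; have [->|f0] := eqVneq f 0.
  by rewrite nm0 mulr0 nm_ge0.
rewrite -(ler_pM2r (nm_gt0 f0)).
have i0 : ip f ('i%C *: f) = 0.
  by have := ip_il f f; rewrite ipC; move: (ip _ _) => x hx; lra.
have Ti0 : ip (T f) ('i%C *: f) = 0.
  have := ip_il (T f) f; rewrite -(linear_opZ lT) sT ipC.
  by move: (ip _ _) => x hx; lra.
have ii : ip ('i%C *: f) ('i%C *: f) = nm f ^+ 2.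
  by rewrite ip_il scalerA -expr2 sqr_i scaleN1r ipNr opprK ipii.
have inm : nm ('i%C *: f) = nm f.
  by move/eqP: ii; rewrite ipii eqrXn2 ?nm_ge0// => /eqP.
have E : ip (T f - z *: f) ('i%C *: f) = - (complex.Im z * nm f ^+ 2).
  rewrite {1}(complexE z) scalerDl (mulrC 'i%C) -scalerA !ipE Ti0 i0 ii.
  by rewrite sub0r mulr0 add0r.
have -> : `|complex.Im z| * nm f * nm f = `|ip (T f - z *: f) ('i%C *: f)|.
  by rewrite E normrN normrM (ger0_norm (sqr_ge0 _)) expr2 mulrA.
by rewrite -[X in _ <= _ * X]inm norm_ip_le.
Qed.

Lemma spectrum_bounded_below T (z : R[i]) : bounded_op T -> ~ spectrum T z ->
  bounded_below (fun f => T f - z *: f).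
Proof.
move=> bT /contrapT[S [/continuous_bounded_op bS SP]].
have [M M0 SM] := bounded_op_gt0 bS; exists M^-1; first by rewrite invr_gt0.
by move=> f; rewrite ler_pdivrMl// -[X in nm X <= _](SP f).1.
Qed.

(** [N] is the operator norm of [T]; vectors nearly attaining it are approximate eigenvectors of
    [T \o T] for [N ^+ 2]. *)
Lemma symmetric_bounded_below_sq T : bounded_op T -> symmetric_op T ->
  (exists f, f != 0) -> exists2 N, bounded_by N T & 0 <= N /\
    ~ bounded_below (fun f => T (T f) - (N ^+ 2)%:C *: f).
Proof.
move=> bT sT [f0 f00]; have [M M0 TM] := bounded_op_gt0 bT.
pose E := [set nm (T f) / nm f | f in [set f : H | f != 0]].
have supE : has_sup E.
  split; first by exists (nm (T f0) / nm f0), f0.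
  by exists M => _ [f f1 <-]; rewrite ler_pdivrMr ?nm_gt0.
pose N := sup E.
have TN : bounded_by N T.
  move=> f; have [->|f1] := eqVneq f 0; first by rewrite (linear_op0 bT.1) !nm0 mulr0.
  by rewrite -ler_pdivrMr ?nm_gt0//; apply: ub_le_sup; [case: supE|exists f].
have N0 : 0 <= N.
  apply: le_trans (_ : nm (T f0) / nm f0 <= N); first by rewrite divr_ge0 ?nm_ge0.
  by apply: ub_le_sup; [case: supE|exists f0].
exists N => //; split => // -[c c0 hc].
(* The choice of [d] below divides by [N ^+ 3], so [N = 0] is treated apart. *)
have [Nz|Npos] := eqVneq N 0.
  have := hc f0; have Tz f : T f = 0.
    by apply/nm_eq0/le_anti; rewrite nm_ge0 andbT (le_trans (TN _))// Nz mul0r.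
  rewrite !Tz Nz expr0n/= scale0r subr0 nm0 leNgt mulr_gt0// nm_gt0//.
have {}Npos : 0 < N by rewrite lt_def Npos.
(* [nm (T (T f) - N^2 f)^2 <= N^2 (N^2 nm f^2 - nm (T f)^2)], which is small
   relative to [nm f^2] when [f] nearly attains the norm [N] of [T]. *)
have key f : nm (T (T f) - (N ^+ 2)%:C *: f) ^+ 2 <=
    N ^+ 2 * (N ^+ 2 * nm f ^+ 2 - nm (T f) ^+ 2).
  rewrite -ipii !ipE !ipii (ipC f (T (T f))) (sT (T f)) ipii.
  have : nm (T (T f)) ^+ 2 <= N ^+ 2 * nm (T f) ^+ 2.
    by rewrite -exprMn lerXn2r ?nnegrE ?nm_ge0 ?mulr_ge0 ?nm_ge0.
  by move: (nm (T (T f))) (nm (T f)) (nm f) => x y z; nra.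
(* [N / 2] keeps [N - d] nonnegative for squaring; the other bound makes [2 N^3 d] at most
   [c^2 / 2], against the assumed lower bound [c^2]. *)
pose d := Num.min (N / 2) (c ^+ 2 / (4 * N ^+ 3)).
have d0 : 0 < d by rewrite lt_min !divr_gt0 ?mulr_gt0 ?exprn_gt0.
have [_ [f f1 <-]] := sup_adherent d0 supE; rewrite -/N => Nd.
have f2 := nm_gt0 f1.
have : N - d <= nm (T f) / nm f by exact: ltW.
rewrite ler_pdivlMr// => Tf.
have dN : d <= N / 2 by rewrite ge_min lexx.
have dc : d * (4 * N ^+ 3) <= c ^+ 2.
  by rewrite -ler_pdivlMr ?mulr_gt0 ?exprn_gt0// ge_min lexx orbT.
have Tf2 : (N - d) ^+ 2 * nm f ^+ 2 <= nm (T f) ^+ 2.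
  rewrite -exprMn lerXn2r ?nnegrE ?nm_ge0// mulr_ge0 ?nm_ge0//; lra.
have := hc f; rewrite -ler_sqr ?nnegrE ?nm_ge0 ?mulr_ge0 ?nm_ge0 ?(ltW c0)//.
move=> /le_trans/(_ (key f)); rewrite leNgt => /negP; apply.
apply: le_lt_trans (_ : N ^+ 2 * (2 * N * d * nm f ^+ 2) < _).
  rewrite ler_pM2l ?exprn_gt0//.
  have : 0 <= d ^+ 2 * nm f ^+ 2 by rewrite mulr_ge0 ?sqr_ge0.
  by move: Tf2; move: (nm f ^+ 2) (nm (T f) ^+ 2) => x y; nra.
rewrite exprMn (_ : N ^+ 2 * _ = (d * (4 * N ^+ 3)) / 2 * nm f ^+ 2); last by field.
rewrite ltr_pM2r ?exprn_gt0//.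
have : 0 < c ^+ 2 by rewrite exprn_gt0.
lra.
Qed.

(** If no root of [q] lay in the spectrum, every linear factor would be bounded below: for nonreal
    roots by symmetry, for real ones by invertibility. *)
Lemma spectrum_root q T : bounded_op T -> symmetric_op T -> q != 0 ->
  ~ bounded_below (op_poly q T) -> exists2 t, spectrum T t%:C & q.[t] = 0.
Proof.
move=> bT sT q0 nb; apply: contrapT => nt; apply: nb; rewrite op_polyE.
have [lT _] := bT; apply: op_cpoly_bounded_below => //.
  by rewrite map_poly_eq0.
move=> z rz; have [z0|z0] := eqVneq (complex.Im z) 0; last exact: bounded_below_im.
have zE : z = (complex.Re z)%:C by case: z z0 {rz} => x y /= ->.
rewrite zE; apply: spectrum_bounded_below => // sz.
apply: nt; exists (complex.Re z) => //.
by move: rz; rewrite zE fmorph_root => /eqP.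
Qed.

Lemma spectrum_neq0 T : bounded_op T -> symmetric_op T -> (exists f, f != 0) ->
  exists t, spectrum T t%:C.
Proof.
move=> bT sT H0; have [N _ [_ nb]] := symmetric_bounded_below_sq bT sT H0.
have [||t st _] := @spectrum_root ('X * 'X - (N ^+ 2)%:P) T bT sT; last by exists t.
  by rewrite -size_poly_eq0 -expr2 size_XnsubC.
move=> [c c0 hc]; apply: nb; exists c => // f; rewrite (le_trans (hc f))//.
by have [lT _] := bT; rewrite op_polyB// op_polyM// !op_polyX op_polyC.
Qed.

Lemma op_poly_norm p T e : bounded_op T -> symmetric_op T -> 0 <= e ->
  (forall t, spectrum T t%:C -> `|p.[t]| <= e) -> bounded_by e (op_poly p T).
Proof.
move=> bT sT e0 pe; have [lT _] := bT.
have [H0|H0] := pselect (exists f : H, f != 0); last first.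
  move=> f; suff -> : f = 0 by rewrite (linear_op0 (op_poly_linear p lT)) !nm0 mulr0.
  by apply: contrapT => /eqP f0; apply: H0; exists f.
have bp := op_poly_bounded p bT; have sp := op_poly_symmetric p lT sT.
have [N hN [N0 nb]] := symmetric_bounded_below_sq bp sp H0.
suff Ne : N <= e by move=> f; rewrite (le_trans (hN f))// ler_wpM2r ?nm_ge0.
pose q := p * p - (N ^+ 2)%:P.
have qE : op_poly q T = fun f => op_poly p T (op_poly p T f) - (N ^+ 2)%:C *: f.
  by apply/funext => f; rewrite /q op_polyB// op_polyM// op_polyC.
have [t st qt] : exists2 t, spectrum T t%:C & q.[t] = 0.
  (* [q] vanishes identically when [p] is the constant [N] or [- N]; any spectral point then
     serves. *)
  have [q0|q0] := eqVneq q 0.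
    by have [t st] := spectrum_neq0 bT sT H0; exists t => //; rewrite q0 horner0.
  by apply: spectrum_root => //; rewrite qE.
have : p.[t] ^+ 2 = N ^+ 2.
  by apply/eqP; rewrite -subr_eq0; move: qt; rewrite /q !hornerE -expr2 => ->.
move=> /(congr1 Num.sqrt); rewrite !sqrtr_sqr (ger0_norm N0) => <-.
exact: pe.
Qed.

End PolynomialCalculus.

(** * Approximation of powers by polynomials *)

Section Bernstein.
Context {R : realType}.
Implicit Types (h : R -> R) (u v : nat -> R) (x y e s : R).

(* [(bernstein n u).[x]] is the expectation of [u] under the binomial law with
   parameters [n] and [x], computed by conditioning on the first trial. *)
Fixpoint bernstein n u : {poly R} :=
  if n is n'.+1 then (1 - 'X) * bernstein n' u + 'X * bernstein n' (u \o S)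
  else (u 0%N)%:P.

Lemma bernsteinS n u x : (bernstein n.+1 u).[x] =
  (1 - x) * (bernstein n u).[x] + x * (bernstein n (u \o S)).[x].
Proof. by rewrite /= !hornerE. Qed.

(** The first two binomial moments. The shift by [S] changes the coefficients, so the induction runs
    over all of them. *)
Lemma bernstein_quadratic n (a b c : R) x :
  (bernstein n (fun k => a * k%:R ^+ 2 + b * k%:R + c)).[x] =
  a * (n%:R * x * (1 - x) + n%:R ^+ 2 * x ^+ 2) + b * (n%:R * x) + c.
Proof.
elim: n a b c => [|n IH] a b c; first by rewrite /= hornerC; ring.
rewrite bernsteinS IH.
rewrite (_ : _ \o _ = fun k => a * k%:R ^+ 2 + (2 * a + b) * k%:R + (a + b + c)).
  by rewrite IH -natr1; ring.
by apply/funext => k /=; rewrite -natr1; ring.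
Qed.

Lemma le_bernstein n u v x : 0 <= x <= 1 -> (forall k, (k <= n)%N -> u k <= v k) ->
  (bernstein n u).[x] <= (bernstein n v).[x].
Proof.
move=> /andP[x0 x1]; elim: n u v => [|n IH] u v uv; first by rewrite !hornerC uv.
rewrite !bernsteinS; apply: lerD; apply: ler_wpM2l; rewrite ?subr_ge0//;
  apply: IH => k kn.
  by apply: uv; apply: leqW.
exact: uv.
Qed.

(** The function is trapped between the parabolas [h x - e - K (y - x)^2] and
    [h x + e + K (y - x)^2], whose expectations involve only the variance
    [x (1 - x) / N <= 1 / N]. *)
Lemma bernstein_approx h e (K : R) n x : 0 <= K ->
  (forall y z, 0 <= y <= 1 -> 0 <= z <= 1 -> `|h y - h z| <= e + K * (y - z) ^+ 2) ->
  0 <= x <= 1 ->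
  `|(bernstein n.+1 (fun k => h (k%:R / n.+1%:R))).[x] - h x| <= e + K / n.+1%:R.
Proof.
move=> K0 hK x01; set N : R := n.+1%:R; have N0 : 0 < N by rewrite ltr0n.
have hk k : (k <= n.+1)%N -> `|h (k%:R / N) - h x| <= e + K * (k%:R / N - x) ^+ 2.
  move=> kn; apply: hK => //; rewrite divr_ge0//=.
  by rewrite ler_pdivrMr// mul1r ler_nat.
have x1 : x * (1 - x) <= 1 by have /andP[] := x01; nra.
have KN : K / N ^+ 2 * (N * x * (1 - x)) <= K / N.
  rewrite (_ : K / N ^+ 2 * _ = K / N * (x * (1 - x))); last by field; rewrite gt_eqF.
  by rewrite -[leRHS]mulr1 ler_wpM2l// divr_ge0// ltW.
rewrite ler_distl; apply/andP; split.
- apply: le_trans (le_bernstein (u := fun k => - (K / N ^+ 2) * k%:R ^+ 2 +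
  2 * K * x / N * k%:R + (h x - e - K * x ^+ 2)) x01 _).
    rewrite bernstein_quadratic -/N.
    rewrite (_ : - (K / N ^+ 2) * _ + _ + _ =
      h x - e - K / N ^+ 2 * (N * x * (1 - x))); last by field; rewrite gt_eqF.
    by move: KN; move: (_ * (N * x * (1 - x))) (K / N) => a b; lra.
  move=> k /hk; rewrite ler_distl => /andP[+ _]; apply: le_trans.
  rewrite le_eqVlt; apply/orP; left; apply/eqP; field; by rewrite gt_eqF.
- apply: le_trans (le_bernstein (v := fun k => (K / N ^+ 2) * k%:R ^+ 2 +
  - (2 * K * x / N) * k%:R + (h x + e + K * x ^+ 2)) x01 _) _.
    move=> k /hk; rewrite ler_distl => /andP[_]; move/le_trans; apply.
    rewrite le_eqVlt; apply/orP; left; apply/eqP; field; by rewrite gt_eqF.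
  rewrite bernstein_quadratic -/N.
  rewrite (_ : K / N ^+ 2 * _ + _ + _ = h x + e + K / N ^+ 2 * (N * x * (1 - x)));
    last by field; rewrite gt_eqF.
  by move: KN; move: (_ * (N * x * (1 - x))) (K / N) => a b; lra.
Qed.

(** Young's inequality for [x] and [y^(s - 1)] with exponents [s] and [s / (s - 1)]; it says that
    [t^s] lies above its tangent at [y]. *)
Lemma powR_tangent s x y : 1 <= s -> 0 <= x -> 0 <= y ->
  s * x * y `^ (s - 1) <= x `^ s + (s - 1) * y `^ s.
Proof.
rewrite le_eqVlt => /predU1P[<-|s1] x0 y0.
  by rewrite subrr powRr0 powRr1// mul0r addr0 mul1r mulr1.
have s0 : 0 < s by lra.
have s10 : 0 < s - 1 by lra.
have := @conjugate_powR _ x (y `^ (s - 1)) s (s /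
  (s - 1)) x0 (powR_ge0 _ _) s0 (divr_gt0 s0 s10).
rewrite -powRrM [(s - 1) * _]mulrC divfK ?gt_eqF//.
have -> : s^-1 + (s / (s - 1))^-1 = 1 by field; rewrite !gt_eqF.
move=> /(_ erefl); rewrite -(ler_pM2l s0) mulrA => /le_trans; apply.
rewrite le_eqVlt; apply/orP; left; apply/eqP; field; by rewrite !gt_eqF.
Qed.

(** The quadratic error is what [bernstein_approx] absorbs. The two ranges of [s] serve the root in
    [op_abs] and the powers taken of it. *)
Lemma powR_modulus s e : s = 2^-1 \/ 1 <= s -> 0 < e -> exists2 K, 0 <= K &
  forall x y, 0 <= x <= 1 -> 0 <= y <= 1 -> `|x `^ s - y `^ s| <= e + K * (x - y) ^+ 2.
Proof.
move=> sE e0.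
suff [K K0 hK] : exists2 K, 0 <= K & forall x y, 0 <= x -> x <= y -> y <= 1 ->
    y `^ s - x `^ s <= e + K * (x - y) ^+ 2.
  exists K => // x y /andP[x0 x1] /andP[y0 y1].
  have s0 : 0 <= s by case: sE => [->|]; lra.
  case: (leP x y) => xy.
    by rewrite distrC ger0_norm ?hK// subr_ge0 ge0_ler_powR.
  rewrite ger0_norm; first by rewrite -sqrrN opprB hK// ltW.
  by rewrite subr_ge0 ge0_ler_powR// ltW.
case: sE => [->|s1].
  (* If the roots differ by more than [e] then [y - x >= e ^+ 2], so this constant makes the
     quadratic term at least 1, the largest possible difference. *)
  exists (e ^+ 4)^-1; first by rewrite invr_ge0 exprn_ge0// ltW.
  move=> x y x0 xy y1; have y0 := le_trans x0 xy.
  rewrite !powR12_sqrt//.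
  have := sqr_sqrtr x0; have := sqr_sqrtr y0.
  move: (sqrtr_ge0 x) (sqrtr_ge0 y); move: (Num.sqrt x) (Num.sqrt y) => a b a0 b0 bE aE.
  have ab : a <= b by rewrite -ler_sqr ?nnegrE// aE bE.
  have b1 : b <= 1 by rewrite -ler_sqr ?nnegrE// bE expr1n.
  have [be|be] := leP (b - a) e.
    by rewrite (le_trans be)// lerDl mulr_ge0 ?sqr_ge0// invr_ge0 exprn_ge0// ltW.
  have d1 : e ^+ 2 <= y - x by rewrite -aE -bE; nra.
  have d2 : e ^+ 4 <= (x - y) ^+ 2.
    by rewrite -(sqrrN (x - y)) opprB (exprM e 2 2) lerXn2r ?nnegrE ?sqr_ge0 ?subr_ge0.
  have : 1 <= (e ^+ 4)^-1 * (x - y) ^+ 2 by rewrite ler_pdivlMl ?exprn_gt0// mulr1.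
  lra.
(* The tangent inequality gives [y^s - x^s <= s (y - x)], and [s d <= e + s^2 d^2 / (4 e)] is a
   completed square. *)
exists (s ^+ 2 / (4 * e)); first by rewrite divr_ge0 ?sqr_ge0//; lra.
move=> x y x0 xy y1; have y0 := le_trans x0 xy.
have := powR_tangent s1 x0 y0.
have s0 : 0 < s by lra.
have yE := mulr_powRB1 y0 s0.
have p1 : y `^ (s - 1) <= 1 by have := @ge0_ler_powR R (s - 1) _ y 1; rewrite powR1;
  apply; rewrite ?nnegrE//; lra.
have p0 : 0 <= y `^ (s - 1) by exact: powR_ge0.
have : 0 <= (1 - y `^ (s - 1)) * s * (y - x) by rewrite !mulr_ge0//; lra.
have : 0 <= (s * (y - x) - 2 * e) ^+ 2 / (4 * e) by rewrite divr_ge0 ?sqr_ge0//; lra.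
have -> : (s * (y - x) - 2 * e) ^+ 2 / (4 * e) =
  s ^+ 2 / (4 * e) * (x - y) ^+ 2 + e - s * (y - x).
  by field; rewrite gt_eqF.
rewrite -yE; move: (s ^+ 2 / (4 * e) * (x - y) ^+ 2) => w; nra.
Qed.

Lemma powR_poly_approx s (M : R) e : s = 2^-1 \/ 1 <= s -> 0 < M -> 0 < e ->
  exists p : {poly R}, forall t, 0 <= t <= M -> `|p.[t] - t `^ s| <= e.
Proof.
move=> sE M0 e0.
have C0 : 0 < M `^ s by rewrite powR_gt0.
(* Half of the error goes to the modulus and half to the variance; dividing by [M^s] anticipates the
   rescaling of [[0, M]] to [[0, 1]]. *)
have e1 : 0 < e / M `^ s / 2 by rewrite !divr_gt0.
have [K K0 hK] := powR_modulus sE e1.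
have K1 : 0 < K + 1 by lra.
have [n hn] := invSn_le (divr_gt0 e1 K1).
pose B := bernstein n.+1 (fun k => (k%:R / n.+1%:R) `^ s).
exists (M `^ s *: (B \Po (M^-1 *: 'X))) => t /andP[t0 tM].
rewrite hornerZ horner_comp hornerZ hornerX.
have t01 : 0 <= M^-1 * t <= 1.
  by rewrite mulr_ge0 ?invr_ge0 ?(ltW M0)//= ler_pdivrMl// mulr1.
have {2}-> : t = M * (M^-1 * t) by rewrite mulrA divff ?gt_eqF// mul1r.
have /andP[t1 _] := t01.
rewrite [in X in _ - X]powRM// ?(ltW M0)// -mulrBr normrM ger0_norm ?(ltW C0)//.
rewrite -ler_pdivlMl// [leRHS]mulrC.
apply: le_trans (@bernstein_approx (fun x => x `^ s) _ K n _ K0 hK t01) _.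
have hK1 := hn n (leqnn n).
have : K / n.+1%:R <= e / M `^ s / 2.
  apply: le_trans (_ : (K + 1) * (e / M `^ s / 2 / (K + 1)) <= _).
    by apply: ler_pM; rewrite ?invr_ge0 ?ler0n// lerDl.
  by rewrite mulrC divfK// gt_eqF.
by move: (K / _) (e / _) => a b; lra.
Qed.

End Bernstein.

(** * Continuous functional calculus *)

Section FunctionalCalculus.
Context {R : realType} {X : Type} {H : rkhs R X}.
Implicit Types (f g : H) (a b c e M K t : R) (T S : H -> H) (p q : {poly R}) (h : R ->
  R).

(** Merges the two limits: one polynomial per tolerance serves both, and the bounds become real. *)
Lemma is_fun_calcP T h S : is_fun_calc T h S <->
  forall e, 0 < e -> exists p, (forall t, spectrum T t%:C -> `|p.[t] - h t| <= e) /\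
    bounded_by e (fun f => op_poly p T f - S f).
Proof.
split=> [[p [ph pS]] e e0|].
  have [N _ hN] := filterI (ph _ e0) (pS _ e0).
  have [h1 h2] := hN N (leqnn N); exists (p N); split => // f.
  by have := h2 f; rewrite le_normE.
move=> hp.
have /choice[p pP] n : exists p, (forall t, spectrum T t%:C ->
  `|p.[t] - h t| <= n.+1%:R^-1) /\
    bounded_by n.+1%:R^-1 (fun f => op_poly p T f - S f).
  by apply: hp; rewrite invr_gt0.
exists p; split => e /invSn_le[N hN]; exists N => // n /hN ne.
  by move=> t /(pP n).1/le_trans; apply.
by move=> f; rewrite le_normE (le_trans ((pP n).2 f))// ler_wpM2r ?nm_ge0.
Qed.

Lemma op_eq_approx S S' : (exists C : H -> R, forall e f, 0 < e ->
  nm (S f - S' f) <= C f * e) ->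
  S = S'.
Proof.
move=> [C hC]; apply/funext => f; apply/eqP; rewrite -subr_eq0;
  apply/eqP/nm_eq0/le_anti.
rewrite nm_ge0 andbT; apply/ler_addgt0Pr => e e0; rewrite add0r.
have C0 : 0 < `|C f| + 1 by rewrite ltr_wpDl.
apply: le_trans (hC (e / (`|C f| + 1)) f (divr_gt0 e0 C0)) _.
rewrite mulrA ler_pdivrMr// mulrC ler_pM2l//.
by rewrite (le_trans (ler_norm _))// lerDl.
Qed.

(** Approximants of the same [h] differ by at most [2 e] on the spectrum, hence as operators by
    [op_poly_norm]; the two remaining errors make [4 e]. *)
Lemma fun_calc_unique T h S S' : bounded_op T -> symmetric_op T ->
  is_fun_calc T h S -> is_fun_calc T h S' -> S = S'.
Proof.
move=> bT sT /is_fun_calcP hS /is_fun_calcP hS'; have [lT _] := bT.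
apply: op_eq_approx; exists (fun f => 4 * nm f) => e f e0.
have [p [ph pS]] := hS e e0; have [q [qh qS]] := hS' e e0.
have e2 : 0 <= e + e by rewrite addr_ge0 ?ltW.
have := @op_poly_norm _ _ _ (p - q) T (e + e) bT sT e2.
have pq t : spectrum T t%:C -> `|(p - q).[t]| <= e + e.
  move=> st; rewrite !hornerE (_ : _ - _ = (p.[t] - h t) - (q.[t] - h t)); last by ring.
  by rewrite (le_trans (ler_normB _ _))// lerD ?ph ?qh.
move=> /(_ pq f); rewrite op_polyB// => pqf.
rewrite (_ : S f - S' f = (op_poly q T f - S' f) - (op_poly p T f - S f) +
  (op_poly p T f - op_poly q T f)).
  apply: le_trans (nmD _ _) _; apply: le_trans (lerD (nmD _ _) (lexx _)) _.
  by rewrite nmN; move: (pS f) (qS f); lra.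
by rewrite opprB -addrA subrKA addrC subrKA.
Qed.

Lemma fun_calc_poly T p : is_fun_calc T (horner p) (op_poly p T).
Proof.
apply/is_fun_calcP => e e0; exists p; split => [t _|f].
  by rewrite subrr normr0 ltW.
by rewrite subrr nm0 mulr_ge0 ?nm_ge0 ?ltW.
Qed.

Lemma fun_calc_eq T h h' S : (forall t, spectrum T t%:C -> h t = h' t) ->
  is_fun_calc T h S -> is_fun_calc T h' S.
Proof.
move=> hh /is_fun_calcP hS; apply/is_fun_calcP => e /hS[p [ph pS]].
by exists p; split => // t st; rewrite -hh// ph.
Qed.

Lemma fun_calc_bounded T h S : bounded_op T -> is_fun_calc T h S -> bounded_op S.
Proof.
move=> bT /is_fun_calcP hS; have [lT _] := bT; split.
  (* [op_eq_approx] compares operators, so the two vectors are presented as constant maps. *)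
  move=> z f g; suff: (fun _ : H => S (z *: f + g)) = (fun _ => z *: S f + S g).
    by move=> /(congr1 (@^~ 0)).
  apply: op_eq_approx; exists (fun _ => nm (z *: f + g) + complex.Re `|z| * nm f +
    nm g) => e _ e0.
  have [p [_ pS]] := hS e e0.
  rewrite (_ : S _ - _ = z *: (op_poly p T f - S f) +
    (op_poly p T g - S g) - (op_poly p T (z *: f + g) - S (z *: f + g))).
    apply: le_trans (nmD _ _) _; apply: le_trans (lerD (nmD _ _) (lexx _)) _.
    rewrite nmN nmZc; move: (pS f) (pS g) (pS (z *: f +
      g)) => /(ler_wpM2l (Re_norm_ge0 z)).
    by lra.
  by rewrite (op_poly_linear p lT) scalerBr addrACA -opprD opprB [RHS]addrC subrKA.
have [p [_ pS]] := hS 1 ltr01.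
have [M M0 pM] := bounded_op_gt0 (op_poly_bounded p bT).
exists (M + 1) => f; rewrite -[S f](subKr (op_poly p T f)).
by apply: le_trans (nmD _ _) _; rewrite nmN mulrDl lerD.
Qed.

Lemma fun_calc_symmetric T h S : bounded_op T -> symmetric_op T ->
  is_fun_calc T h S -> symmetric_op S.
Proof.
move=> [lT _] sT /is_fun_calcP hS f g; apply/eqP; rewrite -subr_eq0 -normr_le0.
apply/ler_addgt0Pr => e e0; rewrite add0r.
pose C := 2 * nm f * nm g + 1.
have C0 : 0 < C by rewrite ltr_wpDl// !mulr_ge0 ?nm_ge0.
have [p [_ pS]] := hS _ (divr_gt0 e0 C0).
rewrite (_ : _ - _ = ip f (op_poly p T g - S g) - ip (op_poly p T f - S f) g);
  last first.
  by rewrite !ipE (op_poly_symmetric p lT sT); ring.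
apply: le_trans (ler_normB _ _) _.
apply: le_trans (_ : 2 * nm f * nm g * (e / C) <= _).
  rewrite (_ : 2 * nm f * nm g * _ = nm f * (e / C * nm g) + e / C * nm f * nm g);
    last by ring.
  rewrite lerD// (le_trans (norm_ip_le _ _))//.
    by rewrite ler_wpM2l ?nm_ge0.
  by rewrite ler_wpM2r ?nm_ge0.
by rewrite mulrCA -[leRHS]mulr1 ler_pM2l// ler_pdivrMr// mul1r lerDl.
Qed.

Lemma fun_calc_comb T h h' S S' a b : linear T -> is_fun_calc T h S ->
  is_fun_calc T h' S' ->
  is_fun_calc T (fun t => a * h t + b * h' t) (fun f => a%:C *: S f + b%:C *: S' f).
Proof.
move=> lT /is_fun_calcP hS /is_fun_calcP hS'; apply/is_fun_calcP => e e0.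
have C0 : 0 < `|a| + `|b| + 1 by rewrite ltr_wpDl// addr_ge0.
have d0 := divr_gt0 e0 C0; set d := e / _ in d0.
have dE : `|a| * d + `|b| * d <= e.
  by rewrite -mulrDl /d mulrCA -[leRHS]mulr1 ler_pM2l// ler_pdivrMr// mul1r lerDl.
clearbody d; have [p [ph pS]] := hS d d0; have [q [qh qS]] := hS' d d0.
exists (a *: p + b *: q); split => [t st|f].
  rewrite !hornerE (_ : _ - _ = a * (p.[t] - h t) + b * (q.[t] - h' t)); last by ring.
  rewrite (le_trans (ler_normD _ _))// (le_trans _ dE)// !normrM.
  by rewrite lerD// ler_wpM2l ?ph ?qh.
rewrite op_polyD !op_polyZ// opprD addrACA -!scalerBr.
rewrite (le_trans (nmD _ _))// !nmZ (le_trans _ (ler_wpM2r (nm_ge0 f) dE))//.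
by rewrite mulrDl -!mulrA; apply: lerD; apply: ler_wpM2l.
Qed.

Lemma fun_calc_mul T h h' S S' K : bounded_op T -> symmetric_op T -> 0 <= K ->
  (forall t, spectrum T t%:C -> `|h t| <= K) ->
    (forall t, spectrum T t%:C -> `|h' t| <= K) ->
  is_fun_calc T h S -> is_fun_calc T h' S' ->
    is_fun_calc T (fun t => h t * h' t) (S \o S').
Proof.
move=> bT sT K0 hK hK' hS hS'; have [lT _] := bT.
have [N N0 SN] := bounded_op_gt0 (fun_calc_bounded bT hS').
move/is_fun_calcP : hS => hS; move/is_fun_calcP : hS' => hS'.
apply/is_fun_calcP => e e0.
have C0 : 0 < 2 * K + 1 + N by lra.
(* [d <= 1] bounds the approximant of [h] by [K + 1]; the divisor dominates [2 K + 1], for the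
   scalar error, and [K + 1 + N], for the operator error. *)
pose d := Num.min 1 (e / (2 * K + 1 + N)).
have d0 : 0 < d by rewrite lt_min ltr01 divr_gt0.
have d1 : d <= 1 by rewrite ge_min lexx.
have dC : d * (2 * K + 1 + N) <= e by rewrite -ler_pdivlMr// ge_min lexx orbT.
have [p [ph pS]] := hS d d0; have [q [qh qS]] := hS' d d0.
have pK t : spectrum T t%:C -> `|p.[t]| <= K + 1.
  move=> st; rewrite -[p.[t]](subrK (h t)) (le_trans (ler_normD _ _))//.
  by move: (ph t st) (hK t st); lra.
have K10 : 0 <= K + 1 by lra.
have pn := op_poly_norm bT sT K10 pK.
exists (p * q); split => [t st|f].
  rewrite hornerM (_ : _ - _ = p.[t] * (q.[t] - h' t) + (p.[t] - h t) * h' t);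
    last by ring.
  rewrite (le_trans (ler_normD _ _))// !normrM (le_trans _ dC)//.
  have := ler_pM (normr_ge0 _) (normr_ge0 _) (pK t st) (qh t st).
  have := ler_pM (normr_ge0 _) (normr_ge0 _) (ph t st) (hK' t st).
  by have := mulr_gt0 d0 N0; lra.
rewrite op_polyM//= (_ : _ - _ =
  op_poly p T (op_poly q T f - S' f) + (op_poly p T (S' f) - S (S' f))); last first.
  by rewrite (linear_opB (op_poly_linear p lT)) addrA subrK.
rewrite (le_trans (nmD _ _))//.
have h1 := le_trans (pn _) (ler_wpM2l K10 (qS f)).
have h2 := le_trans (pS _) (ler_wpM2l (ltW d0) (SN f)).
have := mulr_ge0 (ltW d0) (mulr_ge0 K0 (nm_ge0 f)).
have := ler_wpM2r (nm_ge0 f) dC.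
move: h1 h2; rewrite /=; lra.
Qed.

Lemma fun_calc_ge0 T h S K : bounded_op T -> symmetric_op T ->
  (forall t, spectrum T t%:C -> 0 <= h t <= K) ->
  is_fun_calc T h S -> forall f, 0 <= ip (S f) f.
Proof.
move=> bT sT hK /is_fun_calcP hS f; have [lT _] := bT.
rewrite -oppr_le0; apply/ler_addgt0Pr => e e0; rewrite add0r.
have C0 : 0 < 2 * nm f ^+ 2 + 1 by rewrite ltr_wpDl// mulr_ge0 ?sqr_ge0.
have d0 := divr_gt0 e0 C0; set d := e / _ in d0.
have dE : d * (2 * nm f ^+ 2) <= e.
  by rewrite /d mulrAC ler_pdivrMr// ler_pM2l// lerDl.
clearbody d; have [p [ph pS]] := hS d d0.
(* The absolute value is taken because [K] may be negative when the spectrum has no real point. *)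
have K0 : 0 <= `|K| / 2 + d by rewrite addr_ge0 ?(ltW d0)// divr_ge0.
(* the distance of [p] to the midpoint of [0, K] bounds the norm of [p(T) - K/2] *)
have := @op_poly_norm _ _ _ (p - (`|K| / 2)%:P) T _ bT sT K0.
have hp t : spectrum T t%:C -> `|(p - (`|K| / 2)%:P).[t]| <= `|K| / 2 + d.
  move=> st; have := ph t st; have := hK t st; have := ler_norm K.
  by rewrite !hornerE !ler_norml => ? /andP[? ?] /andP[? ?]; apply/andP; split; lra.
move=> /(_ hp f); rewrite op_polyB// op_polyC => n1.
have h1 := le_trans (norm_ip_le _ _) (ler_wpM2r (nm_ge0 f) n1).
have h2 := le_trans (norm_ip_le _ _) (ler_wpM2r (nm_ge0 f) (pS f)).
move: h1 h2; rewrite !ipE ipii !ler_norml => /andP[h1 _] /andP[_ h2].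
by move: dE h1 h2; rewrite -!mulrA -!expr2; lra.
Qed.

(** By [op_poly_norm] the vectors [p_n(T) f] form a Cauchy sequence, and [S] is their pointwise
    limit. *)
Lemma fun_calc_exists T h : bounded_op T -> symmetric_op T ->
  (forall e, 0 < e -> exists p, forall t, spectrum T t%:C -> `|p.[t] - h t| <= e) ->
  exists S, is_fun_calc T h S.
Proof.
move=> bT sT hp; have [lT _] := bT.
have /choice[p pP] n : exists p, forall t, spectrum T t%:C ->
  `|p.[t] - h t| <= n.+1%:R^-1.
  by apply: hp; rewrite invr_gt0.
have pmn m n f : nm (op_poly (p m) T f - op_poly (p n) T f) <= (m.+1%:R^-1 +
  n.+1%:R^-1) * nm f.
  rewrite -op_polyB//; apply: op_poly_norm => // t st.
  rewrite !hornerE (_ : _ - _ = ((p m).[t] - h t) - ((p n).[t] - h t)); last by ring.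
  by rewrite (le_trans (ler_normB _ _))// lerD ?pP.
have /choice[S SP] f : exists l, forall e, 0 < e -> exists N, forall n, (N <= n)%N ->
    nm (op_poly (p n) T f - l) <= e.
  apply: nm_complete => e e0.
  have C0 : 0 < 2 * (nm f + 1) by rewrite mulr_gt0// ltr_wpDl ?nm_ge0.
  have [N hN] := invSn_le (divr_gt0 e0 C0).
  exists N => m n /hN hm /hN hn; apply: le_trans (pmn _ _ _) _.
  apply: le_trans (ler_wpM2r (nm_ge0 f) (lerD hm hn)) _.
  have f0 : 0 < nm f + 1 by rewrite ltr_wpDl ?nm_ge0.
  rewrite (_ : (_ + _) * _ = e * (nm f / (nm f + 1))); last by field; rewrite gt_eqF.
  by rewrite -[leRHS]mulr1 ler_pM2l// ler_pdivrMr// mul1r lerDl.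
exists S; apply/is_fun_calcP => e e0.
have [N hN] : exists N, forall n, (N <= n)%N -> n.+1%:R^-1 <= e / 2 by apply: invSn_le;
  lra.
exists (p N); split => [t st|f].
  by have := hN N (leqnn N); have := pP N t st; move: (N.+1%:R^-1) => x; lra.
(* The index [N] is uniform in [f]; only the auxiliary [n], along which the limit is taken, depends
   on [f]. *)
apply/ler_addgt0Pr => d d0; have [N' hN'] := SP f d d0.
pose n := maxn N N'.
rewrite -[op_poly _ _ _ - _](subrKA (op_poly (p n) T f)).
rewrite (le_trans (nmD _ _))// lerD ?hN' ?leq_maxr//.
rewrite (le_trans (pmn _ _ _))// ler_wpM2r ?nm_ge0//.
by have := hN N (leqnn N); have := hN n (leq_maxl _ _);
  move: (N.+1%:R^-1) (n.+1%:R^-1) => x y; lra.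
Qed.

(** The spectrum lies in [[0, M]], where [powR_poly_approx] supplies polynomials; hence the choice
    made in [op_pow] meets its specification. *)
Lemma op_pow_fun_calc T s : s = 2^-1 \/ 1 <= s -> bounded_op T -> symmetric_op T ->
  (forall f, 0 <= ip (T f) f) -> is_fun_calc T (fun t => t `^ s) (op_pow T s).
Proof.
move=> sE bT sT T0; have [M M0 TM] := bounded_op_gt0 bT.
have [|S hS] := @fun_calc_exists T (fun t => t `^ s) bT sT.
  move=> e e0; have [p hp] := powR_poly_approx sE M0 e0.
  by exists p => t /(spectrum_itv bT sT T0 TM); apply: hp.
exact: (@getPex _ [set S | is_fun_calc T (fun t => t `^ s) S] (ex_intro _ S hS)).
Qed.

End FunctionalCalculus.

(** * Convexity and power inequalities for real numbers *)

Section ScalarInequalities.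
Context {R : realType}.
Implicit Types (a b s t u v w c m : R).

(** After the induction hypothesis the sides differ by [s t (u - v) (u^n - v^n)], nonnegative
    because powers are monotone. *)
Lemma expr_convex s t u v n : 0 <= s -> 0 <= t -> s + t = 1 -> 0 <= u -> 0 <= v ->
  (s * u + t * v) ^+ n <= s * u ^+ n + t * v ^+ n.
Proof.
move=> s0 t0 st u0 v0; elim: n => [|n IH]; first by rewrite !expr0 !mulr1 st.
have w0 : 0 <= s * u + t * v by rewrite addr_ge0 ?mulr_ge0.
rewrite exprS (le_trans (ler_wpM2l w0 IH))//.
have mono : 0 <= (u - v) * (u ^+ n - v ^+ n).
  have [uv|/ltW vu] := leP u v.
    by apply: mulr_le0; rewrite subr_le0// lerXn2r.
  by apply: mulr_ge0; rewrite subr_ge0// lerXn2r.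
have : 0 <= s * t * ((u - v) * (u ^+ n - v ^+ n)) by rewrite mulr_ge0// mulr_ge0.
have tE : t = 1 - s by rewrite -st; ring.
by rewrite !exprS tE; move: (u ^+ n) (v ^+ n) => x y; lra.
Qed.

(** Source of the subtracted infimum. After the induction hypothesis, with [x = u^n], [y = v^n],
    [c = 2^n], the sides differ by [(u y - v x)^2 + (c - 2) x y (u - v)^2]; starting at exponent 1
    ensures [c >= 2]. *)
Lemma sqr_sum_exp_ge u v n : 0 <= u -> 0 <= v -> (0 < n)%N ->
  (u ^+ n - v ^+ n) ^+ 2 + 2 ^+ n * (u * v) ^+ n <= (u ^+ 2 + v ^+ 2) ^+ n.
Proof.
move=> u0 v0; case: n => // n _; elim: n => [|n IH].
  by rewrite !expr1 le_eqVlt; apply/orP; left; apply/eqP; ring.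
have w0 : 0 <= u ^+ 2 + v ^+ 2 by rewrite addr_ge0 ?sqr_ge0.
rewrite [leRHS]exprS (le_trans _ (ler_wpM2l w0 IH))//.
rewrite ![_ ^+ n.+2]exprS !exprMn.
have x0 : 0 <= u ^+ n.+1 by rewrite exprn_ge0.
have y0 : 0 <= v ^+ n.+1 by rewrite exprn_ge0.
have c2 : 0 <= 2 ^+ n.+1 - 2 :> R by rewrite subr_ge0 -[leLHS]expr1 ler_weXn2l// ler1n.
move: (u ^+ n.+1) (v ^+ n.+1) (2 ^+ n.+1) x0 y0 c2 => x y c x0 y0 c0.
have h1 : 0 <= (u * y - v * x) ^+ 2 by rewrite sqr_ge0.
have h2 := mulr_ge0 (mulr_ge0 c0 (mulr_ge0 x0 y0)) (sqr_ge0 (u - v)).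
by lra.
Qed.

(** The tangent inequalities at the midpoint, added for [a] and [b]; their linear terms cancel. *)
Lemma powR_mean m a b : 1 <= m -> 0 <= a -> 0 <= b ->
  ((a + b) / 2) `^ m <= (a `^ m + b `^ m) / 2.
Proof.
move=> m1 a0 b0; set l := (a + b) / 2.
have l0 : 0 <= l by rewrite /l; lra.
have m0 : 0 < m by lra.
have := powR_tangent m1 a0 l0; have := powR_tangent m1 b0 l0.
have lE := mulr_powRB1 l0 m0.
have -> : a = 2 * l - b by rewrite /l; field.
by rewrite -lE; lra.
Qed.

(** Every element is at most the [n]-th root of [c]. This reduces a bound on a power of [ber] to one
    at each point. *)
Lemma sup_exp_le (E : set R) n c : (0 < n)%N -> E !=set0 ->
  (forall v, E v -> 0 <= v /\ v ^+ n <= c) -> sup E ^+ n <= c.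
Proof.
move=> n0 [e Ee] hE; have [e0 ec] := hE e Ee.
have c0 : 0 <= c by apply: le_trans ec; rewrite exprn_ge0.
pose w := c `^ n%:R^-1.
have wn : w ^+ n = c.
  by rewrite /w -powR_mulrn ?powR_ge0// -powRrM mulVf ?pnatr_eq0 -?lt0n// powRr1.
have ubE : ubound E w.
  by move=> v /hE[v0 vc]; rewrite -(@ler_pXn2r _ n)// ?nnegrE ?powR_ge0// wn.
have sE : 0 <= sup E by apply: le_trans e0 _; apply: ub_le_sup => //; exists w.
rewrite -wn lerXn2r ?nnegrE ?powR_ge0//.
by apply: ge_sup => //; exists e.
Qed.

End ScalarInequalities.

(** * Powers of the absolute value *)

Section AbsoluteValue.
Context {R : realType} {X : Type} {H : rkhs R X}.
Implicit Types (f g k : H) (a b c m M : R) (A T S : H -> H).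

Lemma op_poly_expX n T f : linear T -> op_poly ('X^n) T f = iter n T f.
Proof.
move=> lT; elim: n f => [|n IH] f; first by rewrite expr0 -polyC1 op_polyC scale1r.
by rewrite exprS op_polyM// op_polyX IH.
Qed.

(** Uniqueness against the polynomial ['X^n], which agrees with the real power because the real
    spectrum is nonnegative. *)
Lemma op_pow_nat T n : (0 < n)%N -> bounded_op T -> symmetric_op T ->
  (forall f, 0 <= ip (T f) f) -> op_pow T n%:R = iter n T.
Proof.
move=> n0 bT sT T0; have [M M0 TM] := bounded_op_gt0 bT.
have h1 : is_fun_calc T (fun t => t `^ n%:R) (op_pow T n%:R).
  by apply: op_pow_fun_calc => //; right; rewrite ler1n.
have -> : iter n T = op_poly ('X^n) T by apply/funext => f; rewrite op_poly_expX//;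
  case: bT.
apply: (fun_calc_unique bT sT h1); apply: fun_calc_eq (fun_calc_poly T 'X^n) => t.
by move=> /(spectrum_itv bT sT T0 TM)/andP[t0 _]; rewrite hornerXn powR_mulrn.
Qed.

Lemma bounded_gram A : bounded_op A -> bounded_op (adjoint A \o A).
Proof. by move=> bA; apply: bounded_comp => //; apply: bounded_adjoint. Qed.

Lemma gram_ip A f g : bounded_op A -> ip ((adjoint A \o A) f) g = ip (A f) (A g).
Proof. by move=> bA; rewrite ipC /= -adjoint_ip// ipC. Qed.

Lemma symmetric_gram A : bounded_op A -> symmetric_op (adjoint A \o A).
Proof. by move=> bA f g; rewrite gram_ip// ipC -gram_ip// ipC. Qed.

Lemma gram_ge0 A f : bounded_op A -> 0 <= ip ((adjoint A \o A) f) f.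
Proof. by move=> bA; rewrite gram_ip// ipii sqr_ge0. Qed.

Section Abs.
Context (A : H -> H) (bA : bounded_op A).

Let Q := adjoint A \o A.
Let bQ := bounded_gram bA.
Let sQ := symmetric_gram bA.
Let Q0 f := gram_ge0 f bA.

Let absP : is_fun_calc Q (fun t => t `^ 2^-1) (op_abs A).
Proof. by apply: op_pow_fun_calc => //; left. Qed.

Lemma bounded_abs : bounded_op (op_abs A).
Proof. exact: fun_calc_bounded absP. Qed.

Lemma symmetric_abs : symmetric_op (op_abs A).
Proof. exact: fun_calc_symmetric absP. Qed.

Let root_bound : exists2 K, 0 <= K &
  forall t, spectrum Q t%:C -> 0 <= t `^ 2^-1 <= K.
Proof.
have [M M0 QM] := bounded_op_gt0 bQ; exists (M `^ 2^-1); first exact: powR_ge0.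
move=> t /(spectrum_itv bQ sQ Q0 QM)/andP[t0 tM]; rewrite powR_ge0/=.
by rewrite ge0_ler_powR ?nnegrE// (le_trans t0).
Qed.

Lemma abs_ge0 f : 0 <= ip (op_abs A f) f.
Proof. by have [K _ hK] := root_bound; apply: (fun_calc_ge0 bQ sQ hK absP). Qed.

(** The square of the root is the identity function on the real spectrum of [Q]; multiplicativity
    and uniqueness of the calculus conclude. *)
Lemma abs_sqr : op_abs A \o op_abs A = adjoint A \o A.
Proof.
have [K K0 hK] := root_bound; have [M M0 QM] := bounded_op_gt0 bQ.
have hK' t : spectrum Q t%:C -> `|t `^ 2^-1| <= K.
  by move=> /hK/andP[t0 tK]; rewrite ger0_norm.
have h := fun_calc_mul bQ sQ K0 hK' hK' absP absP.
have QX : op_poly 'X Q = Q by apply/funext => f; rewrite op_polyX.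
have := fun_calc_poly Q 'X; rewrite QX => hX.
apply: (fun_calc_unique bQ sQ h); apply: fun_calc_eq hX => t.
move=> /(spectrum_itv bQ sQ Q0 QM)/andP[t0 _];
  rewrite hornerX powR12_sqrt// -expr2 sqr_sqrtr//.
Qed.

Lemma abs_pow2 : op_pow (op_abs A) 2 = adjoint A \o A.
Proof.
rewrite op_pow_nat//; [exact: abs_sqr | exact: bounded_abs | exact: symmetric_abs | exact: abs_ge0].
Qed.

Lemma abs_pow4 : op_pow (op_abs A) 4 = (adjoint A \o A) \o (adjoint A \o A).
Proof.
rewrite op_pow_nat//; [|exact: bounded_abs|exact: symmetric_abs|exact: abs_ge0].
by rewrite -abs_sqr.
Qed.

Lemma bounded_abs_pow m : 1 <= m -> bounded_op (op_pow (op_abs A) m).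
Proof.
move=> m1; apply: (fun_calc_bounded bounded_abs).
by apply: op_pow_fun_calc;
  [right|exact: bounded_abs|exact: symmetric_abs|exact: abs_ge0].
Qed.

(* McCarthy's inequality, from the tangent of [t `^ m] at the quadratic form. *)
Lemma abs_pow4_mccarthy m k : 1 <= m -> nm k = 1 ->
  ip (op_pow (op_abs A) 4 k) k `^ m <= ip (op_pow (op_abs A) (4 * m) k) k.
Proof.
move=> m1 k1.
have [bC sC C0] : [/\ bounded_op (op_abs A), symmetric_op (op_abs A) &
    forall f, 0 <= ip (op_abs A f) f].
  by split; [exact: bounded_abs|exact: symmetric_abs|exact: abs_ge0].
have [lC _] := bC; have [M M0 CM] := bounded_op_gt0 bC.
have m4 : 1 <= 4 * m by lra.
have hD := op_pow_fun_calc (or_intror m4) bC sC C0.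
have lE : ip (op_pow (op_abs A) 4 k) k =
  ip (iter 4 (op_abs A) k) k by rewrite op_pow_nat.
have l0 : 0 <= ip (op_pow (op_abs A) 4 k) k.
  by rewrite abs_pow4/= (symmetric_gram bA) ipii sqr_ge0.
move: (ip (op_pow (op_abs A) 4 k) k) (op_pow (op_abs A) (4 * m)) lE l0 hD.
move=> l D lE l0 hD.
(* [t^(4 m) + p(t)] is [tau^m] minus its tangent at [l], taken at [tau = t^4], hence nonnegative on
   the spectrum. *)
pose p : {poly R} := ((m - 1) * l `^ m)%:P - (m * l `^ (m - 1)) *: 'X^4.
have hc := fun_calc_comb 1 1 lC hD (fun_calc_poly (op_abs A) p).
pose K := 1 * M `^ (4 * m) + 1 * ((m - 1) * l `^ m).
have hK t : spectrum (op_abs A) t%:C -> 0 <= 1 * t `^ (4 * m) + 1 * p.[t] <= K.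
  move=> /(spectrum_itv bC sC C0 CM)/andP[t0 tM].
  have tm : t `^ (4 * m) = (t ^+ 4) `^ m by rewrite powRrM powR_mulrn.
  have := powR_tangent m1 (exprn_ge0 4 t0) l0; rewrite -tm => tan.
  rewrite /K /p hornerD hornerN hornerZ hornerXn hornerC.
  have h4 : 0 <= m * l `^ (m - 1) * t ^+ 4.
    by rewrite !mulr_ge0 ?powR_ge0 ?exprn_ge0//; lra.
  have hM : t `^ (4 * m) <= M `^ (4 * m).
    by rewrite ge0_ler_powR ?nnegrE ?(ltW M0)//; lra.
  move: (t `^ _) (M `^ _) (l `^ (m - 1)) (l `^ m) (t ^+ 4) tan h4 hM => a b c d w tan h4 hM.
  by apply/andP; split; lra.
have := fun_calc_ge0 bC sC hK hc k.
rewrite !scale1r /p op_polyB// op_polyC op_polyZ// op_poly_expX// !ipE ipii k1 -lE.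
have m0 : 0 < m by lra.
rewrite -(mulr_powRB1 l0 m0); move: (ip _ _) (l `^ _) => a b; lra.
Qed.

End Abs.
End AbsoluteValue.

(** * Buzano's inequality and pointwise bounds for the Berezin number and norm *)

Section Buzano.
Context {R : realType} {X : Type} {H : rkhs R X}.
Implicit Types (f g k : H) (T : H -> H).

(* The reflection [2 <f, k> k - f] has the same norm as [f]. *)
Lemma buzano f g k : nm k = 1 -> ip f k * ip g k <= (nm f * nm g + ip f g) / 2.
Proof.
move=> k1; pose h := (2 * ip f k)%:C *: k - f.
have hf : nm h = nm f.
  have /eqP : nm h ^+ 2 = nm f ^+ 2.
    by rewrite -[LHS]ipii /h !ipE !ipii k1 (ipC k f); ring.
  by rewrite eqrXn2 ?nm_ge0// => /eqP.
by have := ip_le h g; rewrite hf /h !ipE (ipC k g); lra.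
Qed.

Lemma nm_nkern x : kern H x != 0 -> nm (nkern H x) = 1.
Proof.
by move=> k0; rewrite /nm /nkern normrZ normfV normr_id mulVf// normr_eq0.
Qed.

(** Normalized kernels are unit vectors, so a bounded [T] gives a set bounded above, on which [sup]
    is a genuine supremum. *)
Lemma le_ber T x : (forall x, kern H x != 0) -> bounded_op T ->
  complex.Re `|inner H (T (nkern H x)) (nkern H x)| <= ber T.
Proof.
move=> k0 bT; have [M M0 TM] := bounded_op_gt0 bT.
apply: ub_le_sup; last by exists x.
exists M => _ [y _ <-]; apply: le_trans (norm_inner_le _ _) _.
by have := TM (nkern H y); rewrite !nm_nkern// !mulr1.
Qed.

Lemma le_ber_norm T x y : (forall x, kern H x != 0) -> bounded_op T ->
  complex.Re `|inner H (T (nkern H x)) (nkern H y)| <= ber_norm T.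
Proof.
move=> k0 bT; have [M M0 TM] := bounded_op_gt0 bT.
apply: ub_le_sup; last by exists x => //; exists y.
exists M => _ [z _ [w _ <-]]; apply: le_trans (norm_inner_le _ _) _.
by have := TM (nkern H z); rewrite !nm_nkern// !mulr1.
Qed.

End Buzano.

Theorem theorem4p7 (R : realType) (X : Type) (H : rkhs R X)
  (A B : {linear H -> H}) (r : nat) (m zeta : R) :
  inhabited X ->
  (forall x : X, kern H x != 0) ->
  continuous A -> continuous B ->
  (1 <= r)%N -> 1 <= m -> 0 <= zeta ->
  ber (adjoint A \o B) ^+ (2 * r) <=
    (2 * zeta + 1) / (2 * zeta + 2) *
      ber_norm (fun f => 2^-1 *: (op_pow (op_abs B) (4 * m) f
                                  + op_pow (op_abs A) (4 * m) f))
        `^ (r%:R / m)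
    - (2 * zeta + 1) / (2 ^+ r * (2 * zeta + 2)) *
      inf [set (berezin_re (op_pow (op_abs B) 4) x `^ (r%:R / 2)
                - berezin_re (op_pow (op_abs A) 4) x `^ (r%:R / 2)) ^+ 2
          | x in [set: X]]
    + (2 * zeta + 2)^-1 *
      ber (op_pow (op_abs A) 2 \o op_pow (op_abs B) 2) ^+ r.
Proof.
move=> [x0] k0 /continuous_bounded_op bA /continuous_bounded_op bB r1 m1 z0.
set N := ber_norm _; set I := inf _; set W := ber (op_pow _ _ \o _).
(* It suffices to bound the power of each element of the supremum, so a single point [x] is fixed
   from here on. *)
apply: sup_exp_le; first by rewrite muln_gt0.
  by exists (complex.Re `|inner H ((adjoint A \o B) (nkern H x0)) (nkern H x0)|), x0.
move=> _ [x _ <-]; set k := nkern H x; have k1 : nm k = 1 by exact: nm_nkern.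
set al := complex.Re _; have al0 : 0 <= al by exact: Re_norm_ge0.
split => //.
set QA := adjoint A \o A; set QB := adjoint B \o B.
(* [u ^+ 2] and [v ^+ 2] are [<|B|^4 k, k>] and [<|A|^4 k, k>]; [w] below is the mixed term at
   [x]. *)
pose u := nm (QB k); pose v := nm (QA k).
pose w := complex.Re `|inner H (QA (QB k)) k|.
have u0 : 0 <= u by exact: nm_ge0.
have v0 : 0 <= v by exact: nm_ge0.
have w0 : 0 <= w by exact: Re_norm_ge0.
have sA := symmetric_gram bA; have sB := symmetric_gram bB.
have adjl (f g : H) : complex.Re `|inner H (adjoint A f) g| =
  complex.Re `|inner H f (A g)|.
  by rewrite innerC normcJ -adjoint_inner// innerC normcJ.
have wE : w = complex.Re `|inner H (QB k) (QA k)|.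
  by rewrite /w -[QA _]/(adjoint A (A (QB k))) adjl -[in RHS]adjoint_inner.
have wuv : w <= u * v by rewrite wE norm_inner_le.
(* Cauchy-Schwarz for [<B k, A k>], then Buzano for [QB k] and [QA k]. *)
have al2 : al ^+ 2 <= (u * v + w) / 2.
  have alE : al = complex.Re `|inner H (B k) (A k)|.
    by rewrite /al -[(_ \o _) k]/(adjoint A (B k)) adjl.
  have : al ^+ 2 <= (nm (B k) * nm (A k)) ^+ 2.
    by rewrite lerXn2r ?nnegrE ?mulr_ge0 ?nm_ge0// alE norm_inner_le.
  rewrite exprMn -!ipii -!gram_ip// => /le_trans; apply.
  apply: le_trans (buzano _ _ k1) _.
  have : ip (QB k) (QA k) <= w by rewrite wE ip_le_inner.
  by rewrite -/u -/v; lra.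
pose z := 2 * zeta + 2; have z2 : 2 <= z by rewrite /z; lra.
have zE : 2 * zeta + 1 = z - 1 by rewrite /z; ring.
rewrite zE -/z.
have zgt0 : 0 < z by lra.
have alr : al ^+ (2 * r) <= (z - 1) / z * (u * v) ^+ r + z^-1 * w ^+ r.
  rewrite exprM; apply: le_trans (_ : ((z - 1) / z * (u * v) + z^-1 * w) ^+ r <= _).
    (* Since [w <= u v] and [(z - 1) / z >= 1 / 2], shifting weight from [w] to [u v] can only
       increase the mean. *)
    have h : al ^+ 2 <= (z - 1) / z * (u * v) + z^-1 * w.
      apply: le_trans al2 _; rewrite -(ler_pM2l zgt0).
      rewrite (_ : z * (_ + z^-1 * _) = (z - 1) * (u * v) + w); last by field;
        rewrite gt_eqF.
      by nra.
    by rewrite lerXn2r ?nnegrE ?sqr_ge0// (le_trans (sqr_ge0 al)).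
  apply: expr_convex; rewrite ?mulr_ge0 ?invr_ge0 ?(ltW zgt0)//; first lra.
  by field; rewrite gt_eqF.
have wW : w ^+ r <= W ^+ r.
  have wW : w <= W.
    rewrite /w /W !abs_pow2//; apply: (@le_ber _ _ _ (QA \o QB)) => //.
    by apply: bounded_comp; apply: bounded_gram.
  by rewrite lerXn2r ?nnegrE// (le_trans w0).
have bE (T : H -> H) (bT : bounded_op T) :
    berezin_re (op_pow (op_abs T) 4) x = nm ((adjoint T \o T) k) ^+ 2.
  by rewrite abs_pow4// -ipii -(symmetric_gram bT).
have II : I <= (u ^+ r - v ^+ r) ^+ 2.
  apply: ge_inf; first by exists 0 => _ [y _ <-]; rewrite sqr_ge0.
  exists x => //; rewrite (bE A bA) (bE B bB) -/u -/v.
  have pE (t : R) : 0 <= t -> (t ^+ 2) `^ (r%:R / 2) = t ^+ r.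
    by move=> t0; rewrite -powR_mulrn// -powRrM mulrCA divff ?mulr1 ?powR_mulrn.
  by rewrite !pE.
have NN : ((u ^+ 2 + v ^+ 2) / 2) ^+ r <= N `^ (r%:R / m).
  have m0 : 0 < m by lra.
  have m4 : 1 <= 4 * m by lra.
  have DA := bounded_abs_pow bA m4; have DB := bounded_abs_pow bB m4.
  have mcA : (v ^+ 2) `^ m <= ip (op_pow (op_abs A) (4 * m) k) k.
    by rewrite -(bE A bA); apply: abs_pow4_mccarthy.
  have mcB : (u ^+ 2) `^ m <= ip (op_pow (op_abs B) (4 * m) k) k.
    by rewrite -(bE B bB); apply: abs_pow4_mccarthy.
  (* The comparison is made at power [m], where convexity and McCarthy's inequality apply; raising
     to [r / m] then gives the power [r]. *)
  have hN : ((u ^+ 2 + v ^+ 2) / 2) `^ m <= N.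
    apply: le_trans (powR_mean m1 (sqr_ge0 u) (sqr_ge0 v)) _.
    have bD : bounded_op (fun f => 2^-1 *: (op_pow (op_abs B) (4 * m) f +
      op_pow (op_abs A) (4 * m) f)).
      have := bounded_comb 2^-1 2^-1 DB DA; congr bounded_op.
      by apply/funext => f; rewrite scalerDr.
    (* The Berezin norm enters only through its diagonal entry at [x]. *)
    apply: le_trans (le_ber_norm x x k0 bD); apply: le_trans (ip_le_inner _ _).
    have -> : (2^-1 : R[i]) = (2^-1)%:C by rewrite fmorphV rmorph_nat.
    rewrite ipZl ipDl -/k; move: mcA mcB.
    by move: (ip _ _) (ip _ _) ((v ^+ 2) `^ m) ((u ^+ 2) `^ m) => a b c d; lra.
  have uv0 : 0 <= (u ^+ 2 + v ^+ 2) / 2 by rewrite divr_ge0 ?addr_ge0 ?sqr_ge0.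
  have N0 : 0 <= N by rewrite (le_trans _ hN)// powR_ge0.
  rewrite -powR_mulrn// (_ : _ `^ r%:R = (((u ^+ 2 + v ^+ 2) / 2) `^ m) `^ (r%:R / m)).
    by rewrite ge0_ler_powR ?nnegrE ?powR_ge0 ?divr_ge0 ?(ltW m0).
  by rewrite -powRrM mulrCA divff ?mulr1// gt_eqF.
(* [sqr_sum_exp_ge] divided by [2^r], with the square at [x] bounded below by the infimum. *)
have uvr : (u * v) ^+ r <= N `^ (r%:R / m) - I / 2 ^+ r.
  have r2 : 0 < 2 ^+ r :> R by rewrite exprn_gt0.
  rewrite -(ler_pM2l r2) mulrBr [in leRHS]mulrCA divff ?gt_eqF// mulr1.
  have := sqr_sum_exp_ge u0 v0 r1.
  move: NN; rewrite expr_div_n ler_pdivrMr// => NN.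
  by move: (2 ^+ r) ((u * v) ^+ r) ((u ^+ 2 + v ^+ 2) ^+ r) NN II => a b c; lra.
apply: le_trans alr _.
rewrite (_ : (z - 1) / (2 ^+ r * z) * I = (z - 1) / z * (I / 2 ^+ r)); last first.
  by field; rewrite expf_neq0 ?pnatr_eq0//= gt_eqF.
rewrite -mulrBr lerD// ler_wpM2l ?invr_ge0 ?divr_ge0 ?(ltW zgt0)//; lra.
Qed.
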